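(* Let $\xi\in\mathbb{C}$ with $\mathrm{Re}(\xi)>0$ and define $g'_{\xi}\in A$ by $g'_{\xi}(a)=\exp\big(-\pi\xi\sum_{k\in L}a(k)^2\big)$. Then for every $b\in X$, $$(Fg'_{\xi})(b)=B_{\xi}(b)\,g'_{\xi}\!\left(\tfrac{b}{\xi}\right)=B_{\xi}(b)\exp\Big(-\tfrac{\pi}{\xi}\sum_{k\in L}b(k)^2\Big),\qquad B_{\xi}(b)=\sum_{a\in X}\varepsilon_0\exp\Big(-\pi\xi\sum_{k\in L}\big(a(k)+i\tfrac1\xi b(k)\big)^2\Big).$$ Furthermore, if there exists $b_0\in{}^*\mathbb{R}$ with $|b(k)|\le\star(b_0)$ for all $k\in L$, then $$\mathrm{st}(B_{\xi}(b))=\Big({}^{*}\Big(\tfrac{1}{\sqrt{\xi}}\Big)\Big)^{H^2}\in{}^{*}\mathbb{C}\quad\text{and}\quad\mathbf{st}\left(\frac{B_{\xi}(b)}{\star\Big(\big({}^{*}(\tfrac{1}{\sqrt{\xi}})\big)^{H^2}\Big)}\right)=1,$$ with $\sqrt\xi$ the principal square root.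
   Context: Double nonstandard framework: ${}^{*}S=S^{\Lambda_2}/F_2$ for a nonprincipal ultrafilter $F_2$ on an infinite set $\Lambda_2$; for a ${}^*$-internal set $S$, ${}^{\star}S$ is its ${}^*$-ultrapower with respect to ${}^*F_1$, $F_1$ a nonprincipal ultrafilter on an infinite set $\Lambda_1$; ${}^\star x$ or $\star(x)$ is the image of $x$; ''internal'' means internal with a double meaning. $\mathrm{st}$ is the standard part map from elements of ${}^{\star}({}^{*}\mathbb{C})$ bounded by an element of ${}^*\mathbb{R}$ to ${}^*\mathbb{C}$, and $\mathbf{st}=\mathrm{st}\circ\mathrm{st}$ is the standard part with respect to the embedding $\star\circ *:\mathbb{R}\to{}^{\star}({}^*\mathbb{R})$. Let $H\in{}^{*}\mathbb{Z}$ be a positive even infinite number and $H'\in{}^{\star}({}^{*}\mathbb{Z})$ a positive even number larger than every element of ${}^{*}\mathbb{Z}$; $\varepsilon=1/H$, $\varepsilon'=1/H'$. $L=\{\varepsilon z: z\in{}^*\mathbb{Z},\,-H/2\le\varepsilon z<H/2\}$ (size $H^2$), and (this setting) $L'=\{\varepsilon' z': z'\in{}^{\star}({}^{*}\mathbb{Z}),\,-\frac{H'}{2}\le \varepsilon' z'<\frac{H'}{2}\}$, identified with $\varepsilon'\,{}^{\star}({}^*\mathbb{Z})$ modulo $H'$. $X$ is the set of internal functions ${}^{\star}L\to L'$, $A$ the set of internal functions $X\to{}^{\star}({}^{*}\mathbb{C})$, $\varepsilon_0=H'^{-({}^{\star}H)^2}$, and $(Ff)(b)=\sum_{a\in X}\varepsilon_0\exp\big(-2\pi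 i\sum_{k\in L}a(k)b(k)\big)f(a)$. *)

(* Defs.v *)
From HB Require Import structures.
From mathcomp Require Import all_boot all_order all_algebra.
From mathcomp Require Import generic_quotient.
From mathcomp Require Import complex.
From mathcomp Require Import all_classical all_reals all_analysis.

Set Implicit Arguments.
Unset Strict Implicit.
Unset Printing Implicit Defensive.

Import Order.TTheory GRing.Theory Num.Theory.

Local Open Scope classical_set_scope.
Local Open Scope ring_scope.
Local Open Scope complex_scope.
Local Open Scope quotient_scope.

Record npUltraFilter (I : Type) := NpUltraFilter {
  npu_sets :> set I -> Prop;
  npu_ultra : UltraFilter npu_sets;
  npu_nonprincipal : forall i : I, npu_sets <> [set A | A i] }.

#[global] Existing Instance npu_ultra.

Section Ultrapower.
Context (I : Type) (F : npUltraFilter I).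

Definition ae_eq_rel (T : Type) (f g : {classic (I -> T)}) : bool :=
  `[< F [set i | f i = g i] >].

Lemma ae_eq_equiv (T : Type) : equiv_class_of (@ae_eq_rel T).
Proof.
split=> [f|f g|g f h] /=.
- by apply/asboolP; apply: filterS filterT.
- by apply/asboolP/asboolP; apply: filterS => i /= ->.
- move=> /asboolP fg /asboolP gh; apply/asboolP.
  by apply: filterS2 fg gh => i /= -> ->.
Qed.

Definition ae_eq (T : Type) : equiv_rel {classic (I -> T)} :=
  EquivRelPack (ae_eq_equiv T).

Definition upow (T : Type) : Type := {eq_quot @ae_eq T}.

HB.instance Definition _ (T : Type) := Choice.on (upow T).

Definition ucls (T : Type) (f : I -> T) : upow T := \pi_{eq_quot @ae_eq T} f.
Definition urepr (T : Type) (x : upow T) : I -> T :=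
  repr (x : {eq_quot @ae_eq T}).

Definition std (T : Type) (x : T) : upow T := ucls (fun=> x).

Definition umap (T U : Type) (f : T -> U) (x : upow T) : upow U :=
  ucls (fun i => f (urepr x i)).

Definition umap2 (T U V : Type) (f : T -> U -> V) (x : upow T) (y : upow U) :
  upow V := ucls (fun i => f (urepr x i) (urepr y i)).

Definition uapp (T U : Type) (phi : upow (T -> U)) (x : upow T) : upow U :=
  umap2 (fun g t => g t) phi x.

Definition upred (T : Type) (P : T -> Prop) (x : upow T) : Prop :=
  F [set i | P (urepr x i)].

Definition urel (T U : Type) (r : T -> U -> Prop) (x : upow T) (y : upow U) :
  Prop := F [set i | r (urepr x i) (urepr y i)].

Lemma uclsP (T : Type) (f g : I -> T) :
  ucls f = ucls g <-> F [set i | f i = g i].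
Proof.
split=> [/eqP|fg]; first by rewrite eqmodE => /asboolP.
by apply/eqP; rewrite eqmodE; apply/asboolP.
Qed.

Lemma ureprK (T : Type) (x : upow T) : ucls (urepr x) = x.
Proof. exact: reprK. Qed.

Lemma urepr_cls (T : Type) (f : I -> T) : F [set i | urepr (ucls f) i = f i].
Proof. by apply/uclsP; rewrite ureprK. Qed.

Lemma uclsW (T : Type) (P : upow T -> Prop) :
  (forall f, P (ucls f)) -> forall x, P x.
Proof. by move=> Pf x; rewrite -(ureprK x). Qed.

Lemma umap_cls (T U : Type) (f : T -> U) (x : I -> T) :
  umap f (ucls x) = ucls (fun i => f (x i)).
Proof.
by apply/uclsP; apply: filterS (urepr_cls x) => i /= ->.
Qed.

Lemma umap2_cls (T U V : Type) (f : T -> U -> V) (x : I -> T) (y : I -> U) :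
  umap2 f (ucls x) (ucls y) = ucls (fun i => f (x i) (y i)).
Proof.
apply/uclsP.
by apply: filterS2 (urepr_cls x) (urepr_cls y) => i /= -> ->.
Qed.

Lemma upred_cls (T : Type) (P : T -> Prop) (x : I -> T) :
  upred P (ucls x) <-> F [set i | P (x i)].
Proof.
by split; apply: filterS2 (urepr_cls x) => i /= ->.
Qed.

Lemma urel_cls (T U : Type) (r : T -> U -> Prop) (x : I -> T) (y : I -> U) :
  urel r (ucls x) (ucls y) <-> F [set i | r (x i) (y i)].
Proof.
have xy : F [set i | urepr (ucls x) i = x i /\ urepr (ucls y) i = y i].
  by apply: filterS2 (urepr_cls x) (urepr_cls y).
by split; apply: filterS2 xy => i /= [-> ->].
Qed.

Lemma npu_setVsetC (A : set I) : F A \/ F (~` A).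
Proof. exact: in_ultra_setVsetC. Qed.

Lemma npu_or (A B : set I) : F (A `|` B) -> F A \/ F B.
Proof.
move=> AB; have [?|nA] := npu_setVsetC A; first by left.
by right; apply: filterS2 AB nA => i [].
Qed.

Lemma npu_not (A : set I) : F (~` A) <-> ~ F A.
Proof.
split=> [nA FA|]; last by have [] := npu_setVsetC A.
have : F set0 by apply: filterS2 FA nA => i.
exact: filter_not_empty.
Qed.

End Ultrapower.

Arguments ucls {I} F {T} f.
Arguments std {I} F {T} x.
Arguments umap_cls {I F T U}.
Arguments umap2_cls {I F T U V}.
Arguments urel_cls {I F T U}.

Section Zmod.
Context (I : Type) (F : npUltraFilter I) (V : zmodType).
Local Notation uV := (upow F V).

Lemma uaddA : associative (umap2 +%R : uV -> uV -> uV).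
Proof.
move=> x y z; elim/uclsW: x => x; elim/uclsW: y => y; elim/uclsW: z => z.
rewrite (umap2_cls _ y z) (umap2_cls _ x y) !umap2_cls.
by congr (ucls _ _); apply/funext => i; rewrite addrA.
Qed.

Lemma uaddC : commutative (umap2 +%R : uV -> uV -> uV).
Proof.
move=> x y; elim/uclsW: x => x; elim/uclsW: y => y; rewrite !umap2_cls.
by congr (ucls _ _); apply/funext => i; rewrite addrC.
Qed.

Lemma uadd0 : left_id (std F 0) (umap2 +%R : uV -> uV -> uV).
Proof.
move=> x; elim/uclsW: x => x; rewrite umap2_cls.
by congr (ucls _ _); apply/funext => i; rewrite add0r.
Qed.

Lemma uaddN : left_inverse (std F 0) (umap -%R) (umap2 +%R : uV -> uV -> uV).
Proof.
move=> x; elim/uclsW: x => x; rewrite umap_cls umap2_cls.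
by congr (ucls _ _); apply/funext => i; rewrite addNr.
Qed.

HB.instance Definition _ :=
  GRing.isZmodule.Build (upow F V) uaddA uaddC uadd0 uaddN.

End Zmod.

Section ComRing.
Context (I : Type) (F : npUltraFilter I) (A : comNzRingType).
Local Notation uA := (upow F A).

Lemma umulA : associative (umap2 *%R : uA -> uA -> uA).
Proof.
move=> x y z; elim/uclsW: x => x; elim/uclsW: y => y; elim/uclsW: z => z.
rewrite (umap2_cls _ y z) (umap2_cls _ x y) !umap2_cls.
by congr (ucls _ _); apply/funext => i; rewrite mulrA.
Qed.

Lemma umulC : commutative (umap2 *%R : uA -> uA -> uA).
Proof.
move=> x y; elim/uclsW: x => x; elim/uclsW: y => y; rewrite !umap2_cls.
by congr (ucls _ _); apply/funext => i; rewrite mulrC.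
Qed.

Lemma umul1 : left_id (std F 1) (umap2 *%R : uA -> uA -> uA).
Proof.
move=> x; elim/uclsW: x => x; rewrite umap2_cls.
by congr (ucls _ _); apply/funext => i; rewrite mul1r.
Qed.

Lemma umulD : left_distributive (umap2 *%R : uA -> uA -> uA) +%R.
Proof.
move=> x y z; elim/uclsW: x => x; elim/uclsW: y => y; elim/uclsW: z => z.
rewrite /GRing.add/= (umap2_cls _ x y) (umap2_cls _ x z) (umap2_cls _ y z).
rewrite !umap2_cls.
by congr (ucls _ _); apply/funext => i; rewrite mulrDl.
Qed.

Lemma uone_neq0 : std F 1 != 0 :> uA.
Proof.
apply/eqP => /uclsP F01; apply: (@filter_not_empty _ F _).
by apply: filterS F01 => i /= /eqP; rewrite oner_eq0.
Qed.

HB.instance Definition _ := GRing.Zmodule_isComNzRing.Build (upow F A)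
  umulA umulC umul1 umulD uone_neq0.

End ComRing.

Section UnitRing.
Context (I : Type) (F : npUltraFilter I) (A : comUnitRingType).
Local Notation uA := (upow F A).

Definition uunit : pred uA :=
  fun x => `[< upred (fun t => t \is a GRing.unit) x >].

Lemma uunitVl : {in uunit, left_inverse 1 (umap GRing.inv) ( *%R : uA -> _)}.
Proof.
move=> x; elim/uclsW: x => x /asboolP/upred_cls ux.
rewrite /GRing.mul/= umap_cls umap2_cls; apply/uclsP.
by apply: filterS ux => i /= ?; rewrite mulVr.
Qed.

Lemma uunitPl (x y : uA) : y * x = 1 -> uunit x.
Proof.
elim/uclsW: x => x; elim/uclsW: y => y.
rewrite /GRing.mul/= umap2_cls => /uclsP yx; apply/asboolP/upred_cls.
by apply: filterS yx => i /= yx; apply/unitrPr; exists (y i); rewrite mulrC.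
Qed.

Lemma uinv_out : {in [predC uunit], umap GRing.inv =1 @id uA}.
Proof.
move=> x; elim/uclsW: x => x /asboolP nux; rewrite umap_cls; apply/uclsP.
have /npu_not : ~ F [set i | x i \is a GRing.unit].
  by move=> h; apply: nux; apply/upred_cls.
by apply: filterS => i /= /negP; exact: invr_out.
Qed.

HB.instance Definition _ := GRing.ComNzRing_hasMulInverse.Build (upow F A)
  uunitVl uunitPl uinv_out.

End UnitRing.

Section IDomain.
Context (I : Type) (F : npUltraFilter I) (A : idomainType).

Lemma umulf_eq0 (x y : upow F A) : x * y = 0 -> (x == 0) || (y == 0).
Proof.
elim/uclsW: x => x; elim/uclsW: y => y.
rewrite /GRing.mul/= umap2_cls => /uclsP xy.
have /npu_or[x0|y0] : F ([set i | x i = 0] `|` [set i | y i = 0]).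
  apply: filterS xy => i /= /eqP; rewrite mulf_eq0.
  by move=> /orP[]/eqP; [left|right].
- by apply/orP; left; apply/eqP/uclsP.
- by apply/orP; right; apply/eqP/uclsP.
Qed.

HB.instance Definition _ :=
  GRing.ComUnitRing_isIntegral.Build (upow F A) umulf_eq0.

End IDomain.

Section UField.
Context (I : Type) (F : npUltraFilter I) (K : fieldType).

Lemma ufield : GRing.field_axiom (upow F K).
Proof.
move=> x; elim/uclsW: x => x x0; apply/asboolP/upred_cls.
have /npu_not : ~ F [set i | x i = 0].
  by move=> h; move/eqP: x0; apply; apply/uclsP.
by apply: filterS => i /= /eqP; rewrite unitfE.
Qed.

HB.instance Definition _ := GRing.UnitRing_isField.Build (upow F K) ufield.

End UField.

Section UNum.
Context (I : Type) (F : npUltraFilter I) (K : numDomainType).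
Local Notation uK := (upow F K).

Definition ule (x y : uK) : bool := `[< urel (fun s t : K => s <= t) x y >].
Definition ult (x y : uK) : bool := `[< urel (fun s t : K => s < t) x y >].
Definition unorm : uK -> uK := umap Num.norm.

Lemma unormD (x y : uK) : ule (unorm (x + y)) (unorm x + unorm y).
Proof.
elim/uclsW: x => x; elim/uclsW: y => y; apply/asboolP.
rewrite /unorm /GRing.add/= ?(umap_cls, umap2_cls); apply/urel_cls.
by apply: filterS filterT => i _ /=; exact: ler_normD.
Qed.

Lemma uaddr_gt0 (x y : uK) : ult 0 x -> ult 0 y -> ult 0 (x + y).
Proof.
elim/uclsW: x => x; elim/uclsW: y => y /asboolP/urel_cls x0 /asboolP/urel_cls y0.
apply/asboolP; rewrite /GRing.add/= umap2_cls; apply/urel_cls.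
by apply: filterS2 x0 y0 => i /=; exact: addr_gt0.
Qed.

Lemma unorm_eq0 (x : uK) : unorm x = 0 -> x = 0.
Proof.
elim/uclsW: x => x; rewrite /unorm umap_cls => /uclsP x0; apply/uclsP.
by apply: filterS x0 => i /= /eqP; rewrite normr_eq0 => /eqP.
Qed.

Lemma uger_total (x y : uK) : ule 0 x -> ule 0 y -> ule x y || ule y x.
Proof.
elim/uclsW: x => x; elim/uclsW: y => y /asboolP/urel_cls x0 /asboolP/urel_cls y0.
have /npu_or[xy|yx] : F ([set i | x i <= y i] `|` [set i | y i <= x i]).
  apply: filterS2 x0 y0 => i /= x0 y0.
  by have /orP := ger_leVge x0 y0.
- by apply/orP; left; apply/asboolP/urel_cls.
- by apply/orP; right; apply/asboolP/urel_cls.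
Qed.

Lemma unormM : {morph unorm : x y / x * y}.
Proof.
move=> x y; elim/uclsW: x => x; elim/uclsW: y => y.
rewrite /unorm /GRing.mul/= ?(umap_cls, umap2_cls).
by congr (ucls _ _); apply/funext => i; rewrite normrM.
Qed.

Lemma ule_def (x y : uK) : ule x y = (unorm (y - x) == y - x).
Proof.
elim/uclsW: x => x; elim/uclsW: y => y.
rewrite /unorm /GRing.add/GRing.opp/= ?(umap_cls, umap2_cls).
apply/asboolP/eqP => [/urel_cls|/uclsP] xy; [apply/uclsP|apply/urel_cls];
  apply: filterS xy => i /=.
- by rewrite -subr_ge0 => ?; rewrite ger0_norm.
- by move=> /eqP; rewrite -subr_ge0 ger0_def.
Qed.

Lemma ult_def (x y : uK) : ult x y = (y != x) && ule x y.
Proof.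
elim/uclsW: x => x; elim/uclsW: y => y.
apply/asboolP/andP => [/urel_cls xy|[/eqP yx /asboolP/urel_cls xy]].
- split; last by apply/asboolP/urel_cls; apply: filterS xy => i /= /ltW.
  apply/eqP => /uclsP yx; apply: (@filter_not_empty _ F _).
  by apply: filterS2 xy yx => i /= + yx; rewrite yx ltxx.
- have /npu_not nyx : ~ F [set i | y i = x i] by move=> h; apply/yx/uclsP.
  apply/urel_cls; apply: filterS2 xy nyx => i /= xyi /eqP yxi.
  by rewrite lt_def yxi.
Qed.

HB.instance Definition _ := Num.IntegralDomain_isNumRing.Build (upow F K)
  unormD uaddr_gt0 unorm_eq0 uger_total unormM ule_def ult_def.

End UNum.


(* Write * for the F2-extension and # for the second one. The ultrapower      *)
(* formed inside the *-universe with respect to *F1 of the *-internal set     *)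
(* given by a family (S_i)_(i in I2) is, unfolding what * means, the          *)
(* F2-ultraproduct of the F1-ultrapowers of the S_i; for S = *T this is       *)
(* #*T = dpow F1 F2 T.                                                        *)
Notation dpow F1 F2 T := (upow F2 (upow F1 T)).

Section Double.
Context (I1 I2 : Type) (F1 : npUltraFilter I1) (F2 : npUltraFilter I2).

Local Notation dpow T := (dpow F1 F2 T).

Definition starmap (T : Type) (x : upow F2 T) : dpow T := umap (std F1) x.

Definition dstd (T : Type) (x : T) : dpow T := starmap (std F2 x).

Definition dmap (T U : Type) (f : T -> U) : dpow T -> dpow U := umap (umap f).

Definition dmap2 (T U V : Type) (f : T -> U -> V) :
  dpow T -> dpow U -> dpow V := umap2 (umap2 f).

(* Elements of dpow (T -> U) are the internal functions from #*T to #*U, and  *)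
(* dapp is their evaluation.                                                  *)
Definition dapp (T U : Type) (phi : dpow (T -> U)) (x : dpow T) : dpow U :=
  umap2 (@uapp _ F1 T U) phi x.

(* The actual subsets of *T and of #*T given by internal sets.                *)
Definition uext (I : Type) (F : npUltraFilter I) (T : Type)
  (A : upow F (set T)) : set (upow F T) := [set x | urel (fun B t => B t) A x].

Definition dext (T : Type) (A : dpow (set T)) : set (dpow T) :=
  [set x | urel (fun B t => uext B t) A x].

Definition star_set (T : Type) (S : set (upow F2 T)) : set (dpow T) :=
  [set x | exists A : upow F2 (set T), S = uext A /\ dext (starmap A) x].

Definition internal_on (T U : Type) (S : set (dpow T)) (f : dpow T -> dpow U) :
  Prop := exists phi : dpow (T -> U), forall x, S x -> f x = dapp phi x.

(* Sum of the internal function f over the internal hyperfinite set S: the    *)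
(* extension of the finite sum, evaluated at S and at any internal function   *)
(* agreeing with f on S; 0 when S is not hyperfinite or f is not internal.    *)
Definition isum (T : choiceType) (V : zmodType) (S : set (dpow T))
    (f : dpow T -> dpow V) : dpow V :=
  xget 0 [set s | exists (A : dpow (set T)) (phi : dpow (T -> V)),
    [/\ S = dext A,
        upred (upred (@finite_set T)) A,
        forall x, S x -> f x = dapp phi x &
        s = dmap2 (fun B g => \sum_(t \in B) g t) A phi]].

End Double.

Arguments starmap {I1 I2} F1 {F2 T} x.
Arguments dstd {I1 I2} F1 F2 {T} x.
Arguments star_set {I1 I2} F1 {F2 T} S _.

Lemma npu_forall (I : Type) (F : npUltraFilter I) (T : Type) (P Q : I -> set T) :
  (forall x : I -> T, F [set i | P i (x i)] -> F [set i | Q i (x i)]) ->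
  F [set i | P i `<=` Q i].
Proof.
move=> PQ; have [//|nPQ] := npu_setVsetC F [set i | P i `<=` Q i].
have ex i : (~` [set i | P i `<=` Q i]) i -> exists t, P i t /\ ~ Q i t.
  by move=> /existsNP[t /not_implyP[]]; exists t.
have [i0 /ex[t0 _]] := filter_ex nPQ.
have [i|x xP] := @boolp.choice _ _ (fun i t =>
    (~` [set i | P i `<=` Q i]) i -> P i t /\ ~ Q i t).
  have [/ex[t ?]|?] := pselect ((~` [set i | P i `<=` Q i]) i); last by exists t0.
  by exists t.
have Px : F [set i | P i (x i)] by apply: filterS nPQ => i /xP[].
have : F set0 by apply: filterS2 (PQ _ Px) nPQ => i Qx /xP[].
by move=> /(@filter_not_empty _ F _).
Qed.

Lemma uext_inj (I : Type) (F : npUltraFilter I) (T : Type) :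
  injective (@uext I F T).
Proof.
have sub (A B : I -> set T) : uext (ucls F A) `<=` uext (ucls F B) ->
    F [set i | A i `<=` B i].
  move=> AB; apply: npu_forall => x /(urel_cls (fun C t => C t)).
  by move=> /(AB (ucls F x))/urel_cls.
move=> A B; elim/uclsW: A => A; elim/uclsW: B => B AB; apply/uclsP.
have h1 : F [set i | A i `<=` B i] by apply: sub; rewrite AB.
have h2 : F [set i | B i `<=` A i] by apply: sub; rewrite AB.
by apply: filterS2 h1 h2 => i /= ? ?; apply/seteqP.
Qed.

Section SumWellDefined.
Context (I1 I2 : Type) (F1 : npUltraFilter I1) (F2 : npUltraFilter I2).

Lemma dext_inj (T : Type) : injective (@dext I1 I2 F1 F2 T).
Proof.
have sub (A B : I2 -> upow F1 (set T)) : dext (ucls F2 A) `<=` dext (ucls F2 B) ->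
    F2 [set i | uext (A i) `<=` uext (B i)].
  move=> AB; apply: npu_forall => x /(urel_cls (fun C t => uext C t)).
  by move=> /(AB (ucls F2 x))/urel_cls.
move=> A B; elim/uclsW: A => A; elim/uclsW: B => B AB; apply/uclsP.
have h1 : F2 [set i | uext (A i) `<=` uext (B i)] by apply: sub; rewrite AB.
have h2 : F2 [set i | uext (B i) `<=` uext (A i)] by apply: sub; rewrite AB.
by apply: filterS2 h1 h2 => i /= ? ?; apply/uext_inj/seteqP.
Qed.

Lemma isumE (T : choiceType) (V : zmodType) (A : dpow F1 F2 (set T))
    (f : dpow F1 F2 T -> dpow F1 F2 V) (phi : dpow F1 F2 (T -> V)) :
  upred (upred (@finite_set T)) A ->
  (forall x, dext A x -> f x = dapp phi x) ->
  isum (dext A) f = dmap2 (fun B g => \sum_(t \in B) g t) A phi.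
Proof.
move=> finA fphi; rewrite /isum; case: xgetP => [s _|/(_ _)]; last first.
  by move=> /(_ (dmap2 (fun B g => \sum_(t \in B) g t) A phi))[]; exists A, phi.
move=> [A' [psi [/dext_inj <- _ fpsi ->]]] {finA A' s}.
elim/uclsW: A fphi fpsi => A; elim/uclsW: phi => phi; elim/uclsW: psi => psi.
move=> fphi fpsi; rewrite /dmap2 !umap2_cls; apply/uclsP.
have : F2 [set i | uext (A i) `<=`
    [set x | uapp (psi i) x = uapp (phi i) x]].
  apply: npu_forall => x Ax; apply/uclsP.
  have Ax' : dext (ucls F2 A) (ucls F2 x) by apply/urel_cls.
  by rewrite -(umap2_cls (@uapp _ F1 T V)) -(umap2_cls (@uapp _ F1 T V))
    -[LHS]fpsi // -[RHS]fphi.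
apply: filterS => i /=.
elim/uclsW: (A i) => B; elim/uclsW: (psi i) => g; elim/uclsW: (phi i) => h.
move=> gh; rewrite !umap2_cls; apply/uclsP.
have : F1 [set j | B j `<=` [set t | g j t = h j t]].
  apply: npu_forall => x Bx; apply/uclsP.
  rewrite -(umap2_cls (fun g t => g t)) -(umap2_cls (fun g t => g t)).
  by apply: gh; apply/urel_cls.
by apply: filterS => j /= Bgh; apply: eq_fsbigr => t; rewrite inE; exact: Bgh.
Qed.

End SumWellDefined.

Section Transform.
Context (R : realType) (I1 I2 : Type).
Context (F1 : npUltraFilter I1) (F2 : npUltraFilter I2).
Local Notation starR := (upow F2 R).
Local Notation starC := (upow F2 R[i]).
Local Notation starZ := (upow F2 int).
Local Notation dR := (dpow F1 F2 R).
Local Notation dC := (dpow F1 F2 R[i]).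
Local Notation dZ := (dpow F1 F2 int).
Local Notation "c %:D" := (dstd F1 F2 c) (at level 2, format "c %:D").

Definition cexp (z : R[i]) : R[i] :=
  (expR (complex.Re z))%:C *
  (cos (complex.Im z) +i* sin (complex.Im z)).

Definition starC_of (x : starR) : starC := umap (real_complex R) x.
Definition dC_of (x : dR) : dC := dmap (real_complex R) x.
Definition dexp (x : dC) : dC := dmap cexp x.

Definition starC_expz (x : starC) (n : starZ) : starC :=
  umap2 (@exprz R[i]) x n.

(* Norms of elements of R[i] and of its extensions are themselves complex;    *)
(* x <= y there means that y - x is a nonnegative real.                       *)
Definition st_dom (x : dC) : Prop :=
  exists r : starR, `|x| <= starmap F1 (starC_of r).

Definition st (x : dC) : starC :=
  xget 0 [set y : starC | forall e : starR, 0 < e ->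
    `|x - starmap F1 y| < starmap F1 (starC_of e)].

Definition st0_dom (x : starC) : Prop :=
  exists r : R, `|x| <= std F2 r%:C.

Definition st0 (x : starC) : R[i] :=
  xget 0 [set y : R[i] | forall e : R, 0 < e ->
    `|x - std F2 y| < std F2 e%:C].

Definition bst_dom (x : dC) : Prop := st_dom x /\ st0_dom (st x).

Definition bst (x : dC) : R[i] := st0 (st x).

Context (H : starZ) (H' : dZ).

Definition HR : starR := umap intr H.
Definition HR' : dR := dmap intr H'.

Definition latL : set starR :=
  [set x | exists z : starZ, x = HR^-1 * umap intr z /\ - (HR / 2) <= x < HR / 2].

Definition latL' : set dR :=
  [set x | exists z : dZ, x = HR'^-1 * dmap intr z /\ - (HR' / 2) <= x < HR' / 2].

(* An internal function from #L to L' is represented by its extension by 0    *)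
(* outside #L, so that distinct elements of funX are distinct functions.      *)
Definition funX : set (dpow F1 F2 (R -> R)) :=
  [set a | (forall k : dR, star_set F1 latL k -> latL' (dapp a k)) /\
           (forall k : dR, ~ star_set F1 latL k -> dapp a k = 0)].

Definition funA : set (dpow F1 F2 (R -> R) -> dC) :=
  [set f | internal_on funX f].

Definition sumL (V : zmodType) (f : dR -> dpow F1 F2 V) : dpow F1 F2 V :=
  isum (star_set F1 latL) f.

Definition eps0 : dR := dmap2 (@exprz R) HR' (- (starmap F1 H) ^+ 2).

Definition FT (f : dpow F1 F2 (R -> R) -> dC) (b : dpow F1 F2 (R -> R)) : dC :=
  isum funX (fun a => dC_of eps0 *
    dexp (- (2 * (pi%:C)%:D * 'i%:D *
      dC_of (sumL (fun k => dapp a k * dapp b k)))) * f a).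

Definition gauss (xi : R[i]) (c : dR -> dC) : dC :=
  dexp (- ((pi%:C)%:D * xi%:D * sumL (fun k => c k ^+ 2))).

Definition gaussX (xi : R[i]) (a : dpow F1 F2 (R -> R)) : dC :=
  gauss xi (fun k => dC_of (dapp a k)).

Definition Bxi (xi : R[i]) (b : dpow F1 F2 (R -> R)) : dC :=
  isum funX (fun a => dC_of eps0 *
    dexp (- ((pi%:C)%:D * xi%:D *
      sumL (fun k => (dC_of (dapp a k) +
                      'i%:D * (xi%:D)^-1 * dC_of (dapp b k)) ^+ 2)))).

End Transform.

(* Main.v *)
Require Import Defs.
From mathcomp Require Import all_boot all_order all_algebra.
From mathcomp Require Import complex.
From mathcomp Require Import all_classical all_reals all_analysis.
From mathcomp Require Import ring lra zify.
Import Order.TTheory GRing.Theory Num.Theory.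
Import numFieldNormedType.Exports.
Import Normc.
Local Open Scope classical_set_scope.
Local Open Scope ring_scope.
Local Open Scope complex_scope.

(* Everything reduces to estimates on ordinary finite sums: the double        *)
(* ultrapower is an ultrapower over I2 * I1, the internal sets and sums are   *)
(* represented by families of finite lattices and finite sums, and B_xi(b)    *)
(* factors over k into one-dimensional sums                                   *)
(*   sum_x h exp(- pi xi (x + i b(k) / xi)^2),  h = 1 / H'.                   *)
(* With s = sqrt xi, it remains to show that s times such a sum tends to 1 as *)
(* H' grows, uniformly for bounded b. Deform (s, i b / s) linearly to (1, 0): *)
(* the derivative of sigma exp(- pi (sigma x + tau)^2) along the deformation  *)
(* is the x-derivative of (sigma' x + tau') exp(- pi (sigma x + tau)^2), so   *)
(* its Riemann sum telescopes up to O(h). At (1, 0) the sum is a Riemann sum  *)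
(* of the Gauss integral. The number of factors is H^2, which is finite at    *)
(* each index of I2, so the product of the limits is the limit of B_xi(b).    *)

(** The transform formula is algebra at each index. Completing the square at every lattice point, [-
    pi xi a^2 - 2 pi i a b = - pi xi (a + i b / xi)^2 - (pi / xi) b^2], gives an identity of finite
    sums ([gauss_trans_square]), and the class of these identities is the claim.

    The standard parts rest on one limit with explicit uniformity, [gauss_sum_uniform]: the
    one-dimensional sums tend to [1 / sqrt xi] uniformly in [|b| <= b0]. The deformation takes the
    place of a contour shift. It works because the principal root satisfies [|Im s| < Re s], so
    [Re (sigma^2)] stays bounded below along the segment from 1 to [s]; the resulting Gaussian decay
    makes boundary terms and Riemann errors vanish. For fixed [m], the product of [4 m^2] such sums
    then converges ([gauss_trans_cvg]).

    For a tolerance [e i] at each index [i] of [I2] this yields a threshold [m0 i]. The family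
    [2 * m0 i] is an element of the first extension of the integers, hence is exceeded by [H'], so
    the error is below [e] almost everywhere ([Bxi_cvg]). As the tolerance may vary with [i], it can
    be scaled by the modulus of the limit [c], which controls [Bxi / c] even when [c] is
    infinitesimal or infinite. *)

Set Implicit Arguments.
Unset Strict Implicit.
Unset Printing Implicit Defensive.

(** * Complex exponential and derivatives *)

Section Normc.
Context {R : realType}.
Implicit Type z : R[i].

Lemma normc_sqrtE z :
  normc z = Num.sqrt (complex.Re z ^+ 2 + complex.Im z ^+ 2).
Proof. by case: z. Qed.

Lemma normc_ge0 z : 0 <= normc z.
Proof. by rewrite normc_sqrtE sqrtr_ge0. Qed.

Lemma ler_Re_normc z : `|complex.Re z| <= normc z.
Proof. by rewrite normc_sqrtE -sqrtr_sqr ler_wsqrtr// lerDl sqr_ge0. Qed.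

Lemma ler_Im_normc z : `|complex.Im z| <= normc z.
Proof. by rewrite normc_sqrtE -sqrtr_sqr ler_wsqrtr// lerDr sqr_ge0. Qed.

Lemma ler_normc_ReIm z : normc z <= `|complex.Re z| + `|complex.Im z|.
Proof.
have h : 0 <= `|complex.Re z| + `|complex.Im z| by rewrite addr_ge0.
rewrite normc_sqrtE -[leRHS](ger0_norm h) -sqrtr_sqr ler_wsqrtr// sqrrD.
by rewrite !real_normK ?num_real// lerD2r lerDl mulrn_wge0// mulr_ge0.
Qed.

Lemma normc_real (x : R) : normc x%:C = `|x|.
Proof. by rewrite normc_sqrtE/= expr0n addr0 sqrtr_sqr. Qed.

End Normc.

Section CExp.
Context {R : realType}.
Implicit Types z w : R[i].

Lemma cexpD z w : cexp (z + w) = cexp z * cexp w.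
Proof.
case: z w => [a b] [c d]; rewrite /cexp/= expRD cosD sinD.
by apply/eqP; rewrite eq_complex/=; apply/andP; split; apply/eqP; ring.
Qed.

Lemma cexp_real (x : R) : cexp x%:C = (expR x)%:C.
Proof.
rewrite /cexp/= cos0 sin0.
by apply/eqP; rewrite eq_complex/= !mulr1 !mul0r subr0 addr0 mulr0 !eqxx.
Qed.

Lemma cexp0 : cexp 0 = 1 :> R[i].
Proof. by rewrite -[0]/(0%:C) cexp_real expR0. Qed.

Lemma cexp_sum (I : Type) (r : seq I) (P : pred I) (F : I -> R[i]) :
  cexp (\sum_(i <- r | P i) F i) = \prod_(i <- r | P i) cexp (F i).
Proof. exact: (big_morph _ cexpD cexp0). Qed.

Lemma normc_cexp z : normc (cexp z) = expR (complex.Re z).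
Proof.
rewrite /cexp normcM normc_real ger0_norm ?expR_ge0// normc_sqrtE/=.
by rewrite cos2Dsin2 sqrtr1 mulr1.
Qed.

End CExp.

Section CDerive.
Context {R : realType}.
Implicit Types (f g : R -> R[i]) (x : R).

(** Componentwise, so that the mean value theorem can be applied to each real component. *)
Definition is_cderive x f (d : R[i]) : Prop :=
  is_derive x 1 (fun y => complex.Re (f y)) (complex.Re d) /\
  is_derive x 1 (fun y => complex.Im (f y)) (complex.Im d).

Lemma is_cderive_eq x f (d d' : R[i]) :
  is_cderive x f d -> d = d' -> is_cderive x f d'.
Proof. by move=> ? <-. Qed.

Lemma is_cderive_cst (c : R[i]) x : is_cderive x (fun=> c) 0.
Proof. by split; exact: is_derive_cst. Qed.

Lemma is_cderive_real x : is_cderive x (fun y => y%:C) 1.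
Proof. by split; [exact: is_derive_id|exact: is_derive_cst]. Qed.

Lemma is_cderiveD x f g (df dg : R[i]) :
  is_cderive x f df -> is_cderive x g dg ->
  is_cderive x (fun y => f y + g y) (df + dg).
Proof.
have ReD (a b : R[i]) : complex.Re (a + b) = complex.Re a + complex.Re b.
  by case: a b => ? ? [].
have ImD (a b : R[i]) : complex.Im (a + b) = complex.Im a + complex.Im b.
  by case: a b => ? ? [].
move=> [f1 f2] [g1 g2]; split; rewrite (ReD, ImD).
- by under eq_fun do rewrite ReD; exact: is_deriveD.
- by under eq_fun do rewrite ImD; exact: is_deriveD.
Qed.

Lemma is_cderiveM x f g (df dg : R[i]) :
  is_cderive x f df -> is_cderive x g dg ->
  is_cderive x (fun y => f y * g y) (df * g x + f x * dg).
Proof.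
have ReM (a b : R[i]) : complex.Re (a * b) =
    complex.Re a * complex.Re b - complex.Im a * complex.Im b.
  by case: a b => ? ? [].
have ImM (a b : R[i]) : complex.Im (a * b) =
    complex.Re a * complex.Im b + complex.Im a * complex.Re b.
  by case: a b => ? ? [].
move=> [f1 f2] [g1 g2]; split.
- under eq_fun do rewrite ReM.
  apply: (is_derive_eq (is_deriveB (is_deriveM f1 g1) (is_deriveM f2 g2))).
  by rewrite /GRing.scale/=; case: df f1 f2 dg g1 g2 (f x) (g x)
    => ? ? _ _ [? ?] _ _ [? ?] [? ?] /=; ring.
- under eq_fun do rewrite ImM.
  apply: (is_derive_eq (is_deriveD (is_deriveM f1 g2) (is_deriveM f2 g1))).
  by rewrite /GRing.scale/=; case: df f1 f2 dg g1 g2 (f x) (g x)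
    => ? ? _ _ [? ?] _ _ [? ?] [? ?] /=; ring.
Qed.

Lemma is_cderive_sum x n (f : 'I_n -> R -> R[i]) (df : 'I_n -> R[i]) :
  (forall i, is_cderive x (f i) (df i)) ->
  is_cderive x (fun y => \sum_(i < n) f i y) (\sum_(i < n) df i).
Proof.
elim: n f df => [|n IHn] f df fdf.
  rewrite big_ord0 (_ : (fun _ => _) = fun=> 0); first exact: is_cderive_cst.
  by apply/funext => y; rewrite big_ord0.
rewrite big_ord_recr (_ : (fun _ => _) =
    fun y => \sum_(i < n) f (widen_ord (leqnSn n) i) y + f ord_max y).
  by apply: is_cderiveD => //; exact: IHn.
by apply/funext => y; rewrite big_ord_recr.
Qed.

Lemma is_cderive_cexp x f (d : R[i]) : is_cderive x f d ->
  is_cderive x (fun y => cexp (f y)) (d * cexp (f x)).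
Proof.
move=> [f1 f2].
have fE y : cexp (f y) = (expR (complex.Re (f y)) * cos (complex.Im (f y)))
    +i* (expR (complex.Re (f y)) * sin (complex.Im (f y))).
  rewrite /cexp/=.
  by apply/eqP; rewrite eq_complex/= !mul0r subr0 addr0 !eqxx.
have e1 : is_derive x 1 (fun y => expR (complex.Re (f y)))
    (expR (complex.Re (f x)) * complex.Re d).
  exact: (@is_derive1_comp R expR).
have c1 : is_derive x 1 (fun y => cos (complex.Im (f y)))
    (- sin (complex.Im (f x)) * complex.Im d).
  exact: (@is_derive1_comp R (@cos R)).
have s1 : is_derive x 1 (fun y => sin (complex.Im (f y)))
    (cos (complex.Im (f x)) * complex.Im d).
  exact: (@is_derive1_comp R (@sin R)).
split; under eq_fun do rewrite fE/=.
- apply: (is_derive_eq (is_deriveM e1 c1)).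
  rewrite fE; case: d {f1 f2 e1 c1 s1} => d1 d2; rewrite /GRing.scale/=; ring.
- apply: (is_derive_eq (is_deriveM e1 s1)).
  rewrite fE; case: d {f1 f2 e1 c1 s1} => d1 d2; rewrite /GRing.scale/=; ring.
Qed.

End CDerive.

(** Both [A - f] and [A + f] have nonnegative derivative, hence are nondecreasing. This replaces
    integrating the bound [a]. *)
Lemma dist_le_of_derive_le {R : realType} (f g A a : R -> R) (x y : R) :
  x <= y ->
  (forall t, x <= t <= y -> is_derive t 1 f (g t)) ->
  (forall t, x <= t <= y -> is_derive t 1 A (a t)) ->
  (forall t, x <= t <= y -> `|g t| <= a t) ->
  `|f y - f x| <= A y - A x.
Proof.
rewrite le_eqVlt => /predU1P[<- _ _ _|xy fg Aa ga].
  by rewrite !subrr normr0.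
have MV (F dF : R -> R) : (forall t, x <= t <= y -> is_derive t 1 F (dF t)) ->
    (forall t, x <= t <= y -> 0 <= dF t) -> F x <= F y.
  move=> FdF dF0.
  have itv t : t \in `]x, y[ -> x <= t <= y.
    by rewrite in_itv/= => /andP[/ltW -> /ltW ->].
  have [t /itv|/=|c /itv cxy E] := @MVT R F dF x y xy.
  - exact: FdF.
  - apply: derivable_within_continuous => t; rewrite in_itv/=.
    by move=> /FdF[].
  by rewrite -subr_ge0 E mulr_ge0 ?dF0// subr_ge0 ltW.
have h1 : A x - f x <= A y - f y.
  apply: (MV (A \- f) (a \- g)) => t xty /=; last first.
    by rewrite subr_ge0 (le_trans (ler_norm _))// ga.
  by apply: is_deriveB; [exact: Aa|exact: fg].
have h2 : A x + f x <= A y + f y.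
  apply: (MV (A \+ f) (a \+ g)) => t xty /=; last first.
    by rewrite -[g t]opprK subr_ge0 (le_trans (ler_norm _))// normrN ga.
  by apply: is_deriveD; [exact: Aa|exact: fg].
by rewrite ler_norml; apply/andP; split; lra.
Qed.

(* On each cell the error is h times the variation of f, which is dominated   *)
(* by the variation of C * atan; the latter telescopes.                       *)
Lemma riemann_sum_derive {R : realType} (F f g : R -> R) (a h C : R) (n : nat) :
  0 < h ->
  (forall x : R, a < x -> is_derive x 1 F (f x)) ->
  (forall x : R, a < x -> {within `[a, x], continuous F}) ->
  (forall x : R, is_derive x 1 f (g x)) ->
  (forall x : R, `|g x| <= C / (1 + x ^+ 2)) ->
  `|\sum_(z < n) h * f (a + z%:R * h) - (F (a + n%:R * h) - F a)| <=
    h * (C * (atan (a + n%:R * h) - atan a)).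
Proof.
move=> h0 Ff cF fg gC; elim: n => [|n IHn].
  by rewrite big_ord0 mul0r addr0 !subrr normr0 !mulr0.
rewrite big_ord_recr/=.
set x := a + n%:R * h in IHn *; set y := a + n.+1%:R * h.
have yE : y = x + h by rewrite /y /x -natr1 mulrDl mul1r addrA.
have xy : x < y by rewrite yE ltrDl.
have ax : a <= x by rewrite lerDl mulr_ge0// ltW.
have Fxy : {within `[x, y], continuous F}.
  apply: continuous_subspaceW (cF y (le_lt_trans ax xy)) => t /=.
  by rewrite !in_itv/= => /andP[/(le_trans ax) -> ->].
have [t|c cxy E] := @MVT R F f x y xy _ Fxy.
  by rewrite in_itv/= => /andP[xt _]; apply: Ff; exact: le_lt_trans xt.
have yx : y - x = h by rewrite yE; lra.
have /andP[xc cy] : x <= c <= y.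
  by move: cxy; rewrite in_itv/= => /andP[/ltW -> /ltW ->].
have at' (t : R) : is_derive t 1 (fun t : R => C * atan t) (C / (1 + t ^+ 2)).
  exact: (@is_deriveZ R R R atan C t 1).
have V u v : u <= v -> `|f v - f u| <= C * atan v - C * atan u.
  move=> uv; exact: (@dist_le_of_derive_le _ f g (fun t => C * atan t)
    (fun t => C / (1 + t ^+ 2)) u v).
have B : `|f c - f x| <= C * atan y - C * atan x.
  have := V _ _ xc; have := V _ _ cy; have := normr_ge0 (f y - f c); lra.
have -> : \sum_(i < n) h * f (a + i%:R * h) + h * f x - (F y - F a) =
    (\sum_(i < n) h * f (a + i%:R * h) - (F x - F a)) - h * (f c - f x).
  have -> : F y = F x + f c * h by rewrite -yx -E; lra.
  by ring.
apply: (le_trans (ler_normB _ _)).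
rewrite (_ : h * (C * (atan y - atan a)) =
  h * (C * (atan x - atan a)) + h * (C * atan y - C * atan x)); last by ring.
by rewrite lerD// normrM gtr0_norm// ler_pM2l.
Qed.

(** * The real Gaussian *)

Section GaussRiemannSum.
Context {R : realType}.
Local Notation I0 := (@gauss_integral_proof.integral0_gauss R).

Lemma integral0_gauss0 : I0 0 = 0.
Proof.
by rewrite /gauss_integral_proof.integral0_gauss set_itv1 Rintegral_set1.
Qed.

Lemma integrable_gauss_fun (x : R) :
  lebesgue_measure.-integrable `[0, x] (EFin \o @gauss_fun R).
Proof.
apply: continuous_compact_integrable => //; first exact: segment_compact.
by apply: continuous_subspaceT; exact: continuous_gauss_fun.
Qed.

Lemma continuous_integral0_gauss (x : R) : 0 < x ->
  {within `[0, x], continuous I0}.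
Proof.
move=> x0; apply: parameterized_integral_continuous => //; first exact: ltW.
exact: integrable_gauss_fun.
Qed.

Lemma is_derive_integral0_gauss (x : R) : 0 < x ->
  is_derive x 1 I0 (gauss_fun x).
Proof.
move=> x0; have [||||dI I'] := @continuous_FTC1 R gauss_fun (BLeft 0) x (x + 1).
- by rewrite ltrDl.
- exact: integrable_gauss_fun.
- by rewrite /=; rewrite lte_fin.
- exact: continuous_gauss_fun.
by apply: (DeriveDef dI); rewrite -derive1E; exact: I'.
Qed.

(** The known limit is that of the square, [pi / 4]; since [I0] is nonnegative, a square root can be
    taken. *)
Lemma cvg_integral0_gauss : I0 x @[x --> +oo] --> Num.sqrt pi / 2.
Proof.
have : Num.sqrt (I0 x ^+ 2) @[x --> +oo] --> Num.sqrt (pi / 4).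
  apply: continuous_cvg; first exact: sqrt_continuous.
  exact: gauss_integral_proof.cvg_integral0_gauss_sqr.
rewrite sqrtrM ?pi_ge0// sqrtrV// (_ : 4 = 2 ^+ 2); last first.
  by rewrite expr2 -natrM.
rewrite sqrtr_sqr ger0_norm// (_ : (fun _ => Num.sqrt _) = I0)//.
apply/funext => r; rewrite sqrtr_sqr ger0_norm//.
exact: gauss_integral_proof.integral0_gauss_ge0.
Qed.

Lemma is_derive_gauss_fun (x : R) :
  is_derive x 1 gauss_fun (- (2 * x) * gauss_fun x).
Proof.
have d2 : is_derive x 1 (fun y : R => - y ^+ 2) (- (2 * x)).
  have idx := @is_derive_id R R x 1.
  under eq_fun do rewrite expr2.
  apply: (is_derive_eq (is_deriveN (is_deriveM idx idx))).
  by rewrite /GRing.scale/= mulr1 mulr_natl.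
have -> : gauss_fun = expR \o (fun y : R => - y ^+ 2) by [].
by rewrite mulrC; exact: is_derive1_comp.
Qed.

(** Combines [2 |x| <= 1 + x^2] with [1 + x^2 <= 2 exp (x^2 / 2)]; squaring the latter gives
    [(1 + x^2)^2 <= 4 exp (x^2)]. *)
Lemma deriv_gauss_fun_le (x : R) :
  `|- (2 * x) * gauss_fun x| <= 4 / (1 + x ^+ 2).
Proof.
have p : 0 < 1 + x ^+ 2 by rewrite ltr_pwDl// sqr_ge0.
rewrite ler_pdivlMr// normrM normrN (ger0_norm (gauss_fun_ge0 x)).
have h1 : `|2 * x| <= 1 + x ^+ 2.
  by rewrite ler_norml; apply/andP; split; have := sqr_ge0 (x - 1);
    have := sqr_ge0 (x + 1); lra.
have h2 : 1 + x ^+ 2 <= 2 * expR (x ^+ 2 / 2).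
  by have := expR_ge1Dx (x ^+ 2 / 2); have := sqr_ge0 x; lra.
have h3 : (1 + x ^+ 2) * (1 + x ^+ 2) <= 4 * expR (x ^+ 2).
  apply: (le_trans (ler_pM (ltW p) (ltW p) h2 h2)).
  rewrite (_ : 2 * _ * _ = 4 * (expR (x ^+ 2 / 2) * expR (x ^+ 2 / 2))); last by ring.
  by rewrite -expRD -splitr.
rewrite mulrAC (le_trans (ler_wpM2r (gauss_fun_ge0 x) (ler_wpM2r (ltW p) h1)))//.
apply: (le_trans (ler_wpM2r (gauss_fun_ge0 x) h3)).
by rewrite /gauss_fun -mulrA -expRD subrr expR0 mulr1.
Qed.

(* The grid {-m + z h : z < 4 m ^ 2} with h = (2 m)^-1 is the lattice L' of   *)
(* the paper for H' = 2 m.                                                    *)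
Definition grid (m z : nat) : R := - m%:R + z%:R * (2 * m%:R)^-1.

(** The substitution [t = sqrt pi * x] turns the sum into a Riemann sum of [exp (- t^2)] with mesh
    [sqrt pi * h] on [[0, sqrt pi * m]]. The constant is 4 from [deriv_gauss_fun_le] times the bound
    [pi / 2] on [atan]. *)
Lemma half_gauss_sum_le (m : nat) : (0 < m)%N ->
  `|\sum_(z < 2 * m ^ 2)
      (2 * m%:R)^-1 * expR (- (pi * (z%:R * (2 * m%:R)^-1) ^+ 2)) -
    I0 (Num.sqrt pi * m%:R) / Num.sqrt pi| <= 2 * pi * (2 * m%:R)^-1.
Proof.
move=> m0; set h : R := (2 * m%:R)^-1.
have mR : 0 < m%:R :> R by rewrite ltr0n.
have h0 : 0 < h by rewrite invr_gt0 mulr_gt0.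
set p := Num.sqrt pi.
have p0 : 0 < p by rewrite sqrtr_gt0 pi_gt0.
have p2 : p ^+ 2 = pi by rewrite sqr_sqrtr// pi_ge0.
have ph : 0 < p * h by rewrite mulr_gt0.
have := @riemann_sum_derive R I0 gauss_fun (fun x => - (2 * x) * gauss_fun x) 0
  (p * h) 4 (2 * m ^ 2) ph is_derive_integral0_gauss continuous_integral0_gauss
  is_derive_gauss_fun deriv_gauss_fun_le.
rewrite add0r integral0_gauss0 atan0 !subr0.
have -> : (2 * m ^ 2)%:R * (p * h) = p * m%:R.
  by rewrite /h natrM natrX; field; rewrite gt_eqF.
have -> : \sum_(z < 2 * m ^ 2) p * h * gauss_fun (0 + z%:R * (p * h)) =
    p * \sum_(z < 2 * m ^ 2) h * expR (- (pi * (z%:R * h) ^+ 2)).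
  rewrite mulr_sumr; apply: eq_bigr => z _.
  rewrite add0r /gauss_fun [RHS]mulrA; congr (_ * expR _).
  by rewrite -p2; ring.
set S := \sum_(z < _) _ => hS.
have -> : S - I0 (p * m%:R) / p = (p * S - I0 (p * m%:R)) / p.
  by field; rewrite gt_eqF.
rewrite normrM normfV (gtr0_norm p0) ler_pdivrMr// (le_trans hS)//.
have := atan_ltpi2 (p * m%:R) => hat.
rewrite (_ : 2 * pi * h * p = p * h * (4 * (pi / 2))); last by field.
by rewrite ler_pM2l// ler_pM2l// ltW.
Qed.

(** The grid contains [- m] but not [m]. Reflecting its negative half gives the points [h, ..., m]
    instead of [0, ..., m - h], so the two halves differ by the end terms at [m] and at 0. *)
Lemma gauss_sumE (m : nat) : (0 < m)%N ->
  \sum_(z < 4 * m ^ 2) (2 * m%:R)^-1 * expR (- (pi * grid m z ^+ 2)) =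
  2 * (\sum_(z < 2 * m ^ 2)
    (2 * m%:R)^-1 * expR (- (pi * (z%:R * (2 * m%:R)^-1) ^+ 2))) +
  (2 * m%:R)^-1 * (expR (- (pi * m%:R ^+ 2)) - 1).
Proof.
move=> m0; set h : R := (2 * m%:R)^-1; set M := (2 * m ^ 2)%N.
have mR : 0 < m%:R :> R by rewrite ltr0n.
have Mh : M%:R * h = m%:R.
  by rewrite /M /h natrM natrX; field; rewrite gt_eqF.
have -> : (4 * m ^ 2 = M + M)%N by rewrite /M addnn -mul2n mulnA.
rewrite big_split_ord/=.
have -> : \sum_(i < M) h * expR (- (pi * grid m (M + i) ^+ 2)) =
    \sum_(i < M) h * expR (- (pi * (i%:R * h) ^+ 2)).
  apply: eq_bigr => i _; congr (_ * expR (- (_ * _ ^+ 2))).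
  by rewrite /grid natrD mulrDl -/h Mh; ring.
have -> : \sum_(i < M) h * expR (- (pi * grid m i ^+ 2)) =
    \sum_(i < M) h * expR (- (pi * (i.+1%:R * h) ^+ 2)).
  rewrite (reindex_inj rev_ord_inj)/=; apply: eq_bigr => i _.
  congr (_ * expR (- (_ * _))).
  rewrite /grid natrB; last exact: ltn_ord.
  by rewrite mulrBl -/h Mh; ring.
set f := fun i : nat => h * expR (- (pi * (i%:R * h) ^+ 2)).
rewrite -/(f _).
have -> : \sum_(i < M) h * expR (- (pi * (i.+1%:R * h) ^+ 2)) =
    \sum_(i < M) f i + f M - f 0.
  have <- : \sum_(i < M.+1) f i = \sum_(i < M) f i + f M.
    by rewrite big_ord_recr.
  by rewrite big_ord_recl/= addrAC subrr add0r.
rewrite -/(\sum_(i < M) f i) {2 3}/f mul0r expr0n mulr0 oppr0 expR0 Mh; ring.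
Qed.

Lemma gauss_sum_cvg (e : R) : 0 < e -> exists2 m0, (0 < m0)%N &
  forall m, (m0 <= m)%N ->
  `|\sum_(z < 4 * m ^ 2) (2 * m%:R)^-1 * expR (- (pi * grid m z ^+ 2)) - 1| < e.
Proof.
move=> e0.
set p : R := Num.sqrt pi.
have p0 : 0 < p by rewrite sqrtr_gt0 pi_gt0.
have pe : 0 < p * (e / 8) by rewrite mulr_gt0// divr_gt0.
have /cvgrPdist_lt/(_ _ pe) [A [_ hA]] := cvg_integral0_gauss.
(* The first term brings the integral up to [p * m] within [p * e / 8] of its limit. The second
   makes [(4 pi + 1) h < e / 2], which covers twice the error [2 pi h] of a half sum and the end
   correction, at most [h]. *)
pose K : R := `|A| / p + (4 * pi + 1) / e.
exists (Num.truncn K).+1 => // m Km.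
have mK : K < m%:R.
  by apply: (lt_le_trans (truncnS_gt _)); rewrite ler_nat.
have mR : 0 < m%:R :> R by rewrite ltr0n (leq_trans _ Km).
have pi0 := @pi_gt0 R.
have K1 : 0 <= `|A| / p by rewrite divr_ge0// ltW.
have K2 : 0 <= (4 * pi + 1) / e by rewrite divr_ge0// ltW//; lra.
have Apm : A < p * m%:R.
  rewrite (le_lt_trans (ler_norm _))// mulrC -ltr_pdivrMr//.
  by apply: le_lt_trans mK; rewrite /K lerDl.
have hI := hA _ Apm.
rewrite gauss_sumE; last by rewrite (leq_trans _ Km).
set h := (2 * m%:R)^-1.
have h0 : 0 < h by rewrite invr_gt0 mulr_gt0.
have := half_gauss_sum_le (leq_trans (ltn0Sn _) Km); rewrite -/h -/p.
set S := \sum_(z < _) _ => hS.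
have hI' : `|I0 (p * m%:R) / p - 1 / 2| < e / 8.
  rewrite (_ : _ - _ = - (p / 2 - I0 (p * m%:R)) / p); last first.
    by field; rewrite gt_eqF.
  by rewrite normrM normrN normfV (gtr0_norm p0) ltr_pdivrMr// [ltRHS]mulrC.
have hh : (4 * pi + 1) * h < e / 2.
  rewrite /h invfM mulrA ltr_pdivrMr// mulrC.
  have : (4 * pi + 1) / e < m%:R by apply: le_lt_trans mK; rewrite /K lerDr.
  by rewrite ltr_pdivrMr// => ?; lra.
have hexp : 0 <= expR (- (pi * m%:R ^+ 2) : R) <= 1.
  by rewrite expR_ge0 -expR0 ler_expR oppr_le0 mulr_ge0 ?sqr_ge0 ?ltW.
set E := expR _ in hexp *.
have hE : `|h * (E - 1)| <= h.
  rewrite normrM gtr0_norm// -[leRHS]mulr1 ler_pM2l//.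
  by rewrite ler_norml; apply/andP; split; move/andP: hexp => []; lra.
move: hS hI' hE; rewrite !ler_norml !ltr_norml.
move=> /andP[? ?] /andP[? ?] /andP[? ?]; apply/andP; split; lra.
Qed.

End GaussRiemannSum.

(** * Deformation of the Gaussian *)

Section Deformation.
Context {R : realType}.
Implicit Types (u v s t w : R[i]) (x : R).

(** The power 5 is 3 for the cubic prefactor of [gprim2] plus 2 for the remaining decay
    [1 / (1 + x^2)]. In the exponent, [Re ((s x + t)^2)] is at least [d x^2 - 2 M^2 |x| - M^2], and
    [(1 + |x|)^5] costs at most [5 (1 + |x|)]; [B] collects the linear terms. *)
Lemma cexp_sqr_decay (q d M : R) : 0 < q -> 0 < d -> 0 <= M -> exists2 K : R, 0 < K &
  forall s t x, normc s <= M -> normc t <= M -> d <= complex.Re (s ^+ 2) ->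
  normc (cexp (- (q%:C * (s * x%:C + t) ^+ 2))) * (1 + `|x|) ^+ 5 <= K.
Proof.
move=> q0 d0 M0.
pose B : R := 2 * q * M ^+ 2 + 5.
exists (expR (B ^+ 2 / (4 * q * d) + q * M ^+ 2 + 5)).
  exact: expR_gt0.
move=> s t x sM tM sd.
have Q5 : (1 + `|x|) ^+ 5 <= expR (5 * (1 + `|x|)).
  rewrite expRM_natl lerXn2r ?nnegrE ?addr_ge0 ?expR_ge0//.
  by rewrite -subr_ge0; have := expR_ge1Dx (1 + `|x|); lra.
rewrite normc_cexp (le_trans (ler_wpM2l (expR_ge0 _) Q5))// -expRD ler_expR.
have tx : `|complex.Re (s * t)| <= M ^+ 2.
  rewrite (le_trans (ler_Re_normc _))// normcM expr2.
  by rewrite ler_pM ?normc_ge0.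
have tt : `|complex.Re (t ^+ 2)| <= M ^+ 2.
  rewrite (le_trans (ler_Re_normc _))// !expr2 normcM.
  by rewrite ler_pM ?normc_ge0.
have -> : complex.Re (- (q%:C * (s * x%:C + t) ^+ 2)) =
    - (q * (x ^+ 2 * complex.Re (s ^+ 2) + 2 * (x * complex.Re (s * t)) +
      complex.Re (t ^+ 2))).
  by case: s t {sM tM sd tx tt} => a b [a' b'] /=; ring.
set y := `|x|.
have xy : x ^+ 2 = y ^+ 2 by rewrite /y real_normK ?num_real.
have h1 : d * y ^+ 2 <= x ^+ 2 * complex.Re (s ^+ 2).
  by rewrite xy mulrC ler_wpM2l// sqr_ge0.
have h2 : - (y * M ^+ 2) <= x * complex.Re (s * t).
  rewrite lerNl (le_trans (ler_norm _))// normrN normrM ler_wpM2l//.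
have h3 : - M ^+ 2 <= complex.Re (t ^+ 2).
  by rewrite lerNl (le_trans (ler_norm _))// normrN.
have h4 : q * (d * y ^+ 2 - 2 * (y * M ^+ 2) - M ^+ 2) <=
   q * (x ^+ 2 * complex.Re (s ^+ 2) + 2 * (x * complex.Re (s * t)) +
      complex.Re (t ^+ 2)).
  by rewrite ler_pM2l//; lra.
(* The linear term is absorbed by the quadratic one by completing the square. *)
have h5 : B * y <= B ^+ 2 / (4 * q * d) + q * d * y ^+ 2.
  rewrite -subr_ge0.
  rewrite (_ : _ - _ = (B - 2 * q * d * y) ^+ 2 / (4 * q * d)); last first.
    by field; rewrite !gt_eqF.
  by rewrite divr_ge0 ?sqr_ge0// !mulr_ge0// ltW.
move: h4 h5; rewrite /B; lra.
Qed.

(** [gprim1] and [gprim2] are its first two derivatives in [x]. The parameters [u], [v] stand for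
    the velocities of [s], [t] along the deformation. *)
Definition gprim u v s t x : R[i] :=
  (u * x%:C + v) * cexp (- (pi%:C * (s * x%:C + t) ^+ 2)).

Definition gprim1 u v s t x : R[i] :=
  (u - 2 * pi%:C * s * (s * x%:C + t) * (u * x%:C + v)) *
  cexp (- (pi%:C * (s * x%:C + t) ^+ 2)).

Definition gprim2 u v s t x : R[i] :=
  (- (2 * pi%:C * s * s * (u * x%:C + v)) -
   2 * pi%:C * s * (s * x%:C + t) * u -
   2 * pi%:C * s * (s * x%:C + t) *
     (u - 2 * pi%:C * s * (s * x%:C + t) * (u * x%:C + v))) *
  cexp (- (pi%:C * (s * x%:C + t) ^+ 2)).

Lemma is_cderive_affine u v x : is_cderive x (fun y => u * y%:C + v) u.
Proof.
apply: (is_cderive_eq (is_cderiveD (is_cderiveM (is_cderive_cst u x)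
  (is_cderive_real x)) (is_cderive_cst v x))).
by rewrite mul0r add0r mulr1 addr0.
Qed.

Lemma is_cderive_cexp_sqr (w : R -> R[i]) (dw : R[i]) x : is_cderive x w dw ->
  is_cderive x (fun y => cexp (- (pi%:C * w y ^+ 2)))
    (- (2 * pi%:C * dw * w x) * cexp (- (pi%:C * w x ^+ 2))).
Proof.
move=> wdw.
have E (y : R) : - (pi%:C * w y ^+ 2) = - pi%:C * (w y * w y) by ring.
rewrite (_ : (fun y => _) = fun y => cexp (- pi%:C * (w y * w y))); last first.
  by apply/funext => y; rewrite E.
apply: (is_cderive_eq (is_cderive_cexp (is_cderiveM (is_cderive_cst (- pi%:C) x)
  (is_cderiveM wdw wdw)))).
by rewrite E; ring.
Qed.

Lemma is_cderive_gprim u v s t x :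
  is_cderive x (gprim u v s t) (gprim1 u v s t x).
Proof.
apply: (is_cderive_eq (is_cderiveM (is_cderive_affine u v x)
  (is_cderive_cexp_sqr (is_cderive_affine s t x)))).
by rewrite /gprim1; ring.
Qed.

Lemma is_cderive_gprim1 u v s t x :
  is_cderive x (gprim1 u v s t) (gprim2 u v s t x).
Proof.
have P : is_cderive x (fun y => u - 2 * pi%:C * s * (s * y%:C + t) * (u * y%:C + v))
   (- (2 * pi%:C * s * s * (u * x%:C + v)) - 2 * pi%:C * s * (s * x%:C + t) * u).
  rewrite (_ : (fun y => _) = fun y =>
    u + (- (2 * pi%:C * s)) * ((s * y%:C + t) * (u * y%:C + v))).
    apply: (is_cderive_eq (is_cderiveD (is_cderive_cst u x)
      (is_cderiveM (is_cderive_cst (- (2 * pi%:C * s)) x)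
      (is_cderiveM (is_cderive_affine s t x) (is_cderive_affine u v x))))).
    by ring.
  by apply/funext => y; ring.
apply: (is_cderive_eq (is_cderiveM P
  (is_cderive_cexp_sqr (is_cderive_affine s t x)))).
by rewrite /gprim2; ring.
Qed.

(* The r-derivative is an x-derivative, so the Riemann sums over x are nearly *)
(* independent of r.                                                          *)
Lemma is_cderive_deform u v x (r : R) :
  is_cderive r (fun y => (1 + u * y%:C) *
      cexp (- (pi%:C * ((1 + u * y%:C) * x%:C + v * y%:C) ^+ 2)))
    (gprim1 u v (1 + u * r%:C) (v * r%:C) x).
Proof.
have A : is_cderive r (fun y => 1 + u * y%:C) u.
  rewrite (_ : (fun y => _) = fun y => u * y%:C + 1).
    exact: is_cderive_affine.
  by apply/funext => y; rewrite addrC.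
have B : is_cderive r (fun y => (1 + u * y%:C) * x%:C + v * y%:C) (u * x%:C + v).
  rewrite (_ : (fun y => _) = fun y => (u * x%:C + v) * y%:C + x%:C).
    exact: is_cderive_affine.
  by apply/funext => y; ring.
apply: (is_cderive_eq (is_cderiveM A (is_cderive_cexp_sqr B))).
by rewrite /gprim1; ring.
Qed.

End Deformation.

Section DeformationBounds.
Context {R : realType}.
Implicit Types (u v s t z w : R[i]) (x : R).

Lemma normcD_le z w (a b : R) : normc z <= a -> normc w <= b ->
  normc (z + w) <= a + b.
Proof. by move=> za wb; apply: (le_trans (le_normcD z w)); exact: lerD. Qed.

Lemma normcN_le z (a : R) : normc z <= a -> normc (- z) <= a.
Proof. by move=> za; rewrite (normcN z). Qed.

Lemma normcM_le z w (a b : R) : normc z <= a -> normc w <= b ->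
  normc (z * w) <= a * b.
Proof. by move=> za wb; rewrite normcM ler_pM ?normc_ge0. Qed.

(** The polynomial prefactors are at most [c (1 + |x|)^3], where [c] adds up the bounds of their
    terms; [cexp_sqr_decay] absorbs the rest. [C] depends only on [d] and [M], which makes the final
    limit uniform in [b]. *)
Lemma gprim_decay (d M : R) : 0 < d -> 1 <= M -> exists2 C : R, 0 < C &
  forall u v s t x, normc u <= M -> normc v <= M -> normc s <= M ->
    normc t <= M -> d <= complex.Re (s ^+ 2) ->
  normc (gprim u v s t x) <= C / (1 + x ^+ 2) /\
  normc (gprim2 u v s t x) <= C / (1 + x ^+ 2).
Proof.
move=> d0 M1; have M0 : 0 <= M by exact: le_trans M1.
rewrite /gprim /gprim2; move: (@pi_gt0 R); set p := pi; move: p => p p0.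
have [K K0 HK] := cexp_sqr_decay p0 d0 M0.
pose c : R := M + 6 * p * M ^+ 3 + 4 * p ^+ 2 * M ^+ 5.
have X n : 0 <= M ^+ n by rewrite exprn_ge0.
have c1 : 0 <= 6 * p * M ^+ 3 by rewrite !mulr_ge0// ltW.
have c2 : 0 <= 4 * p ^+ 2 * M ^+ 5 by rewrite !mulr_ge0// ltW.
exists (c * K); first by rewrite mulr_gt0// /c; lra.
move=> u v s t x uM vM sM tM sd; have := HK s t x sM tM sd.
set E := cexp _; set Q := 1 + `|x| => HE.
have Q1 : 1 <= Q by rewrite /Q lerDl.
have Q0 : 0 <= Q by exact: le_trans Q1.
have QX n : 0 <= Q ^+ n by rewrite exprn_ge0.
have Q3 : Q <= Q ^+ 3 by rewrite -[leLHS]expr1 ler_weXn2l.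
have x2 : 1 + x ^+ 2 <= Q ^+ 2.
  rewrite -[x ^+ 2]real_normK ?num_real// /Q.
  by have := normr_ge0 x; rewrite !expr2; lra.
have x0 : 0 < 1 + x ^+ 2 by rewrite ltr_pwDl// sqr_ge0.
have Pc P : normc P <= c * Q ^+ 3 -> normc (P * E) <= c * K / (1 + x ^+ 2).
  move=> HP; rewrite normcM ler_pdivlMr//.
  have E0 := normc_ge0 E.
  apply: (@le_trans _ _ (c * Q ^+ 3 * normc E * Q ^+ 2)).
    by apply: ler_pM (ltW x0) _ x2; [rewrite mulr_ge0 ?normc_ge0|rewrite ler_wpM2r].
  rewrite (_ : _ * Q ^+ 2 = c * (normc E * Q ^+ 5)); last by ring.
  by rewrite ler_wpM2l// /c; lra.
have xQ : normc (x%:C) <= `|x| by rewrite normc_real.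
have aff z w : normc z <= M -> normc w <= M -> normc (z * x%:C + w) <= M * Q.
  move=> zM wM; rewrite /Q mulrDr mulr1 addrC.
  by apply: normcD_le => //; exact: normcM_le.
have su := aff _ _ uM vM; have st := aff _ _ sM tM.
have n2 : normc (2 * p%:C) <= 2 * p.
  have -> : 2 * p%:C = (2 * p)%:C by rewrite rmorphM rmorph_nat.
  by rewrite normc_real ger0_norm// mulr_ge0// ltW.
split; apply: Pc.
- apply: (le_trans su); apply: (@le_trans _ _ (M * Q ^+ 3)).
    by rewrite ler_wpM2l.
  by rewrite ler_wpM2r// /c; lra.
- have h1 := normcM_le n2 sM.
  have h2 := normcM_le (normcM_le h1 sM) su.
  have h3 := normcM_le h1 st.
  have h4 := normcM_le h3 uM.
  have h5 := normcM_le h3 (normcD_le uM (normcN_le (normcM_le h3 su))).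
  apply: (le_trans (normcD_le (normcD_le (normcN_le h2) (normcN_le h4))
    (normcN_le h5))).
  rewrite (_ : _ + _ = 6 * p * M ^+ 3 * Q + 4 * p ^+ 2 * M ^+ 5 * Q ^+ 3);
    last by ring.
  have h6 : 6 * p * M ^+ 3 * Q <= 6 * p * M ^+ 3 * Q ^+ 3 by rewrite ler_wpM2l.
  have h7 : 0 <= M * Q ^+ 3 by rewrite mulr_ge0.
  by rewrite /c; lra.
Qed.

Lemma grid_end (m : nat) : (0 < m)%N -> grid m (4 * m ^ 2) = m%:R :> R.
Proof.
move=> m0; rewrite /grid natrM natrX; field.
by rewrite pnatr_eq0 -lt0n.
Qed.

(** A Riemann sum of an exact derivative is the difference of the end values of [gprim], each at
    most [C / (1 + m^2)], up to an error [h C pi], as [atan] varies by less than [pi]. The outer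
    factor 2 comes from treating real and imaginary parts separately. *)
Lemma sum_gprim1_le u v s t (C : R) (m : nat) : (0 < m)%N ->
  (forall x, normc (gprim u v s t x) <= C / (1 + x ^+ 2) /\
    normc (gprim2 u v s t x) <= C / (1 + x ^+ 2)) ->
  normc (\sum_(z < 4 * m ^ 2) (2 * m%:R)^-1%:C * gprim1 u v s t (grid m z)) <=
  2 * ((2 * m%:R)^-1 * (C * pi) + 2 * (C / (1 + m%:R ^+ 2))).
Proof.
move=> m0 HC; set h : R := (2 * m%:R)^-1.
have mR : 0 < m%:R :> R by rewrite ltr0n.
have h0 : 0 < h by rewrite invr_gt0 mulr_gt0.
have C0 : 0 <= C.
  have [+ _] := HC 0; rewrite expr0n addr0 divr1.
  by apply: le_trans; exact: normc_ge0.
have key (P : R[i] -> R) : (forall w, `|P w| <= normc w) ->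
    (forall f d x, is_cderive x f d -> is_derive x 1 (fun y => P (f y)) (P d)) ->
    `|\sum_(z < 4 * m ^ 2) h * P (gprim1 u v s t (grid m z))| <=
      h * (C * pi) + 2 * (C / (1 + m%:R ^+ 2)).
  move=> Pn Pd.
  have dF x : is_derive x 1 (fun x => P (gprim u v s t x)) (P (gprim1 u v s t x)).
    by apply: Pd; exact: is_cderive_gprim.
  have df x : is_derive x 1 (fun x => P (gprim1 u v s t x)) (P (gprim2 u v s t x)).
    by apply: Pd; exact: is_cderive_gprim1.
  have cF x : - m%:R < x ->
      {within `[- m%:R, x], continuous (fun x => P (gprim u v s t x))}.
    by move=> _; apply: derivable_within_continuous => y _; have [] := dF y.
  have gC x : `|P (gprim2 u v s t x)| <= C / (1 + x ^+ 2).
    by apply: (le_trans (Pn _)); have [] := HC x.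
  have := riemann_sum_derive (4 * m ^ 2) h0 (fun x _ => dF x) cF df gC.
  rewrite -/(grid m (4 * m ^ 2)) (grid_end m0) => RS.
  have FC x : `|P (gprim u v s t x)| <= C / (1 + x ^+ 2).
    by apply: (le_trans (Pn _)); have [] := HC x.
  have F1 := FC m%:R; have := FC (- m%:R); rewrite sqrrN => F2.
  have RS' : h * (C * (atan m%:R - atan (- m%:R))) <= h * (C * pi).
    rewrite ler_pM2l// ler_wpM2l//.
    by have := @atan_ltpi2 R m%:R; have := @atan_gtNpi2 R (- m%:R); lra.
  have := le_trans RS RS'.
  set S := \sum_(z < _) _ => {}RS.
  rewrite -/S.
  move: RS F1 F2; rewrite !ler_norml => /andP[? ?] /andP[? ?] /andP[? ?].
  by apply/andP; split; lra.
have k1 := key (@complex.Re R) (@ler_Re_normc R) (fun f d x H => H.1).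
have k2 := key (@complex.Im R) (@ler_Im_normc R) (fun f d x H => H.2).
apply: (le_trans (ler_normc_ReIm _)).
rewrite [X in `|X| + _](_ : _ =
  \sum_(z < 4 * m ^ 2) h * complex.Re (gprim1 u v s t (grid m z))); last first.
  rewrite raddf_sum/=; apply: eq_bigr => z _.
  by case: (gprim1 _ _ _ _ _) => a b /=; ring.
rewrite [X in _ + `|X|](_ : _ =
  \sum_(z < 4 * m ^ 2) h * complex.Im (gprim1 u v s t (grid m z))); last first.
  rewrite raddf_sum/=; apply: eq_bigr => z _.
  by case: (gprim1 _ _ _ _ _) => a b /=; ring.
by rewrite mulr_natl mulr2n lerD.
Qed.

Lemma cdist_le_of_cderive_le (f g : R -> R[i]) (D : R) :
  (forall r, is_cderive r f (g r)) -> (forall r, 0 <= r <= 1 -> normc (g r) <= D) ->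
  normc (f 1 - f 0) <= 2 * D.
Proof.
move=> fg gD.
have dD (t : R) : is_derive t 1 (fun y : R => D * y) D.
  by apply: (is_derive_eq (is_deriveZ D (is_derive_id t 1))); rewrite /GRing.scale/= mulr1.
have key (P : R[i] -> R) : (forall w, `|P w| <= normc w) ->
    (forall f d x, is_cderive x f d -> is_derive x 1 (fun y => P (f y)) (P d)) ->
    `|P (f 1) - P (f 0)| <= D.
  move=> Pn Pd; have := @dist_le_of_derive_le R (fun y => P (f y))
    (fun y => P (g y)) (fun y => D * y) (fun=> D) 0 1 ler01.
  rewrite mulr1 mulr0 subr0; apply => // t t01; first exact: Pd.
  by apply: (le_trans (Pn _)); exact: gD.
have k1 := key (@complex.Re R) (@ler_Re_normc R) (fun f d x H => H.1).
have k2 := key (@complex.Im R) (@ler_Im_normc R) (fun f d x H => H.2).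
apply: (le_trans (ler_normc_ReIm _)); rewrite mulr_natl mulr2n.
by case: (f 1) (f 0) k1 k2 => [a b] [a' b'] /= k1 k2; exact: lerD.
Qed.

(** Along [s = 1 + u r], [t = v r] the sum starts at the real Gaussian sum for [r = 0]. Its
    [r]-derivative is the sum of [gprim1], small by [sum_gprim1_le], so the value at [r = 1] is
    close to the initial one. *)
Lemma deform_sum_le u v (C : R) (m : nat) : (0 < m)%N ->
  (forall r x, 0 <= r <= 1 ->
    normc (gprim u v (1 + u * r%:C) (v * r%:C) x) <= C / (1 + x ^+ 2) /\
    normc (gprim2 u v (1 + u * r%:C) (v * r%:C) x) <= C / (1 + x ^+ 2)) ->
  normc (\sum_(z < 4 * m ^ 2) (2 * m%:R)^-1%:C * ((1 + u) *
      cexp (- (pi%:C * ((1 + u) * (grid m z)%:C + v) ^+ 2))) -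
    (\sum_(z < 4 * m ^ 2) (2 * m%:R)^-1 * expR (- (pi * grid m z ^+ 2)))%:C) <=
  2 * (2 * ((2 * m%:R)^-1 * (C * pi) + 2 * (C / (1 + m%:R ^+ 2)))).
Proof.
move=> m0 HC; set h : R := (2 * m%:R)^-1.
pose f (r : R) : R[i] := \sum_(z < 4 * m ^ 2) h%:C * ((1 + u * r%:C) *
  cexp (- (pi%:C * ((1 + u * r%:C) * (grid m z)%:C + v * r%:C) ^+ 2))).
pose g (r : R) : R[i] := \sum_(z < 4 * m ^ 2)
  h%:C * gprim1 u v (1 + u * r%:C) (v * r%:C) (grid m z).
have fg r : is_cderive r f (g r).
  apply: is_cderive_sum => z.
  apply: (is_cderive_eq (is_cderiveM (is_cderive_cst h%:C r)
    (is_cderive_deform u v (grid m z) r))).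
  by rewrite mul0r add0r.
have := cdist_le_of_cderive_le fg (fun r r01 =>
  sum_gprim1_le m0 (fun x => HC r x r01)).
congr (normc (_ - _) <= _).
  by apply: eq_bigr => z _; rewrite !mulr1.
rewrite /f rmorph_sum; apply: eq_bigr => z _.
by rewrite !mulr0 addr0 !mul1r addr0 -rmorphXn -rmorphM -rmorphN cexp_real -rmorphM.
Qed.

End DeformationBounds.

(** * The one-dimensional limit, uniform in b *)

Section GaussLimit.
Context {R : realType}.

(** [Re xi = (Re s)^2 - (Im s)^2] for [s = sqrtc xi], and the principal root has [Re s >= 0]. *)
Lemma Re_sqrtc_gt (xi : R[i]) : 0 < complex.Re xi ->
  `|complex.Im (sqrtc xi)| < complex.Re (sqrtc xi).
Proof.
move=> xi0.
have s0 : 0 <= complex.Re (sqrtc xi) by case: xi {xi0} => a b /=; exact: sqrtr_ge0.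
have : complex.Re (sqrtc xi ^+ 2) = complex.Re (sqrtc xi) ^+ 2 - complex.Im (sqrtc xi) ^+ 2.
  by case: (sqrtc xi) => a b /=; ring.
rewrite sqr_sqrtc => E; rewrite E subr_gt0 in xi0.
by rewrite -(@ltr_pXn2r _ 2) ?nnegrE// real_normK ?num_real.
Qed.

Lemma gauss_sum_uniform (xi : R[i]) (b0 e : R) : 0 < complex.Re xi -> 0 < e ->
  exists2 m0, (0 < m0)%N & forall m, (m0 <= m)%N -> forall b, `|b| <= b0 ->
  normc (\sum_(z < 4 * m ^ 2) (2 * m%:R)^-1%:C *
      cexp (- (pi%:C * xi * ((grid m z)%:C + 'i * xi^-1 * b%:C) ^+ 2)) -
    (sqrtc xi)^-1) < e.
Proof.
move=> xi0 e0; set s := sqrtc xi.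
have := Re_sqrtc_gt xi0; rewrite -/s ltr_norml => /andP[sl sr].
have sxi : xi = s ^+ 2 by rewrite sqr_sqrtc.
have s0 : s != 0.
  by apply/eqP => s0; move: sl sr; rewrite s0/= oppr0 => /lt_trans h /h; rewrite ltxx.
have ns : 0 < normc s.
  by rewrite lt_neqAle normc_ge0 andbT eq_sym; apply: contra s0 => /eqP/eq0_normc ->.
pose u := s - 1.
(* [Re (sigma^2) = (Re sigma - Im sigma) (Re sigma + Im sigma)]. On the segment from 1 to [s] each
   factor is a convex combination of 1 and its value at [s], hence at least [d0]; so
   [Re (sigma^2) >= d0 * d0]. *)
pose d0 := Num.min 1 (Num.min (complex.Re s - complex.Im s) (complex.Re s + complex.Im s)).
have d00 : 0 < d0 by rewrite !lt_min ltr01/=; apply/andP; split; lra.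
have [d1 d2 d3] : [/\ d0 <= 1, d0 <= complex.Re s - complex.Im s &
    d0 <= complex.Re s + complex.Im s].
  by rewrite /d0 !ge_min !lexx/= !orbT.
pose M := 1 + normc u + `|b0| / normc s.
have M1 : 1 <= M by rewrite /M -addrA lerDl addr_ge0 ?normc_ge0// divr_ge0 ?normc_ge0.
have [C C0 HC] := gprim_decay (mulr_gt0 d00 d00) M1.
have es : 0 < e * normc s / 2 by rewrite divr_gt0// mulr_gt0.
have [m1 m10 Hm1] := gauss_sum_cvg es.
(* With [h = 1 / (2 m)] the deformation error is [2 pi C / m + 8 C / (1 + m^2)], at most
   [(2 pi C + 8 C) / m]. The other half of [e * normc s] is left to the real Gaussian sum. *)
pose K := (2 * pi * C + 8 * C) / (e * normc s / 2).
exists (maxn m1 (Num.truncn K).+1); first by rewrite leq_max m10.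
move=> m; rewrite geq_max => /andP[m1m Km] b bb0.
have m0 : (0 < m)%N by exact: leq_trans m1m.
have mR : 0 < m%:R :> R by rewrite ltr0n.
have mK : K < m%:R by apply: (lt_le_trans (truncnS_gt _)); rewrite ler_nat.
(* Since [xi = s^2], this gives [xi (x + i b / xi)^2 = (s x + v)^2]. *)
pose v : R[i] := 'i * b%:C / s.
have uM : normc u <= M.
  rewrite /M -addrA addrCA lerDl addr_ge0//.
  by rewrite divr_ge0 ?normc_ge0.
have ni : normc ('i : R[i]) = 1 by rewrite normc_sqrtE/= expr0n expr1n add0r sqrtr1.
have vb : normc v <= `|b0| / normc s.
  rewrite /v !normcM normcV normc_real ni mul1r ler_wpM2r ?invr_ge0 ?normc_ge0//.
  by rewrite (le_trans bb0)// ler_norm.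
have vM : normc v <= M.
  by rewrite (le_trans vb)// /M lerDr addr_ge0 ?normc_ge0.
have HCr (r x : R) : 0 <= r <= 1 ->
    normc (gprim u v (1 + u * r%:C) (v * r%:C) x) <= C / (1 + x ^+ 2) /\
    normc (gprim2 u v (1 + u * r%:C) (v * r%:C) x) <= C / (1 + x ^+ 2).
  move=> /andP[r0 r1]; apply: HC => //.
  - apply: (@le_trans _ _ (1 + normc u)).
      apply: normcD_le; first by rewrite normc1.
      by rewrite normcM normc_real ger0_norm// ler_piMr ?normc_ge0.
    by rewrite /M lerDl divr_ge0 ?normc_ge0.
  - by rewrite normcM normc_real ger0_norm// (le_trans _ vM)// ler_piMr ?normc_ge0.
  - have -> : complex.Re ((1 + u * r%:C) ^+ 2) =
        ((1 - r) + r * (complex.Re s - complex.Im s)) *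
        ((1 - r) + r * (complex.Re s + complex.Im s)).
      by rewrite /u; case: (s) => a b' /=; ring.
    by apply: ler_pM; rewrite ?(ltW d00)//; nra.
have := deform_sum_le m0 HCr.
have -> : 1 + u = s by rewrite /u addrC subrK.
set h : R := (2 * m%:R)^-1.
have := Hm1 _ m1m; rewrite -/h; set T := \sum_(z < _) _ => HT.
set S := \sum_(z < 4 * m ^ 2) h%:C * cexp (- (pi%:C * xi * _)).
have -> : \sum_(z < 4 * m ^ 2) h%:C * (s * cexp (- (pi%:C * (s * (grid m z)%:C + v) ^+ 2)))
    = s * S.
  rewrite mulr_sumr; apply: eq_bigr => z _; rewrite mulrCA; congr (_ * (_ * cexp (- _))).
  rewrite -mulrA; congr (_ * _); rewrite sxi /v; field.
  by [].
move=> HS.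
have -> : S - s^-1 = (s * S - 1) / s by field.
rewrite normcM normcV ltr_pdivrMr//.
have -> : s * S - 1 = (s * S - T%:C) + (T - 1)%:C.
  by rewrite rmorphB/=; ring.
apply: (le_lt_trans (le_normcD _ _)); rewrite normc_real.
rewrite (splitr (e * normc s)); apply: ler_ltD => //.
apply: (le_trans HS).
have -> : 2 * (2 * (h * (C * pi) + 2 * (C / (1 + m%:R ^+ 2)))) =
  (2 * pi * C) / m%:R + 8 * C / (1 + m%:R ^+ 2).
  by rewrite /h invfM; lra.
have mm : (1 + m%:R ^+ 2)^-1 <= (m%:R)^-1 :> R.
  rewrite lef_pV2 ?posrE// ?ltr_pwDl ?sqr_ge0//.
  have : 1 <= m%:R :> R by rewrite ler1n.
  by rewrite expr2; nra.
apply: (@le_trans _ _ ((2 * pi * C + 8 * C) / m%:R)).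
  by rewrite [leRHS]mulrDl lerD2l ler_wpM2l// mulr_ge0// ltW.
rewrite ler_pdivrMr// [leRHS]mulrC -ler_pdivrMr//.
exact: ltW.
Qed.

End GaussLimit.

(** * Finite lattices *)

Lemma fsbig_image_ord (V : nmodType) (J : choiceType) (n : nat) (g : nat -> J)
    (F : J -> V) : set_inj `I_n g ->
  \sum_(x \in g @` `I_n) F x = \sum_(z < n) F (g z).
Proof. by move=> gi; rewrite fsbig_image// -fsbig_ord. Qed.

Section FunctionSum.
Context {R : realType}.

(** Extension by 0 outside [L], as in [funX], makes the functions on a finite lattice a finite
    set. *)
Definition funs (L L' : set R) : set (R -> R) :=
  [set a | (forall k, L k -> L' (a k)) /\ (forall k, ~ L k -> a k = 0)].

Context (n p : nat) (f g : nat -> R).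
Context (finj : set_inj `I_n f) (ginj : set_inj `I_p g).

Definition fun_of_ffun (phi : {ffun 'I_n -> 'I_p}) : R -> R :=
  fun r => if [pick i : 'I_n | f i == r] is Some i then g (phi i) else 0.

Lemma fun_of_ffunE phi (i : 'I_n) : fun_of_ffun phi (f i) = g (phi i).
Proof.
rewrite /fun_of_ffun; case: pickP => [j /eqP fji|/(_ i)]; last by rewrite eqxx.
by congr (g (phi _)); apply/val_inj/finj => //; rewrite inE/= ltn_ord.
Qed.

Lemma fun_of_ffun_inj : injective fun_of_ffun.
Proof.
move=> phi psi e; apply/ffunP => i; apply/val_inj/ginj; rewrite ?inE/= ?ltn_ord//.
by rewrite -!fun_of_ffunE e.
Qed.

Lemma funs_image :
  funs (f @` `I_n) (g @` `I_p) = fun_of_ffun @` [set: {ffun 'I_n -> 'I_p}].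
Proof.
apply/seteqP; split => [a [a1 a2]|_ [phi _ <-]] /=.
- have H (i : 'I_n) : exists j : 'I_p, g j = a (f i).
    have [|j /= jp E] := a1 (f i); first by exists (i : nat) => //=; exact: ltn_ord.
    by exists (Ordinal jp).
  have [phi phiP] := boolp.choice H.
  exists [ffun i => phi i] => //; apply/funext => r; rewrite /fun_of_ffun.
  case: pickP => [i /eqP <-|nr]; first by rewrite ffunE phiP.
  apply/esym/a2 => -[i /= ip E].
  by have := nr (Ordinal ip); rewrite /= E eqxx.
- split => k.
  + move=> [i /= ip <-]; rewrite (fun_of_ffunE phi (Ordinal ip)).
    by exists (phi (Ordinal ip) : nat) => //=; exact: ltn_ord.
  + move=> nk; rewrite /fun_of_ffun; case: pickP => // i /eqP E.
    by exfalso; apply: nk; exists (i : nat) => //=; exact: ltn_ord.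
Qed.

Lemma finite_funs : finite_set (funs (f @` `I_n) (g @` `I_p)).
Proof. by rewrite funs_image; apply: finite_image. Qed.

(** Distributivity: choosing one term in each factor is choosing a function. This is what factors
    [Bxi] into one-dimensional sums. *)
Lemma sum_funs_prod (A : comNzRingType) (G : 'I_n -> R -> A) :
  \sum_(a \in funs (f @` `I_n) (g @` `I_p)) \prod_(i < n) G i (a (f i)) =
  \prod_(i < n) \sum_(j < p) G i (g j).
Proof.
rewrite funs_image fsbig_image; last by move=> ? ? _ _; exact: fun_of_ffun_inj.
rewrite bigA_distr_bigA -[RHS]big_enum/= [RHS]fsbig_seq ?enum_uniq//.
have -> : [set: {ffun 'I_n -> 'I_p}] = [set` enum {ffun 'I_n -> 'I_p}].
  by apply/seteqP; split => phi //= _; rewrite mem_enum.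
apply: eq_fsbigr => phi _; apply: eq_bigr => i _.
by rewrite fun_of_ffunE.
Qed.

End FunctionSum.

(** * Lattices as grids, and the factorization and limit at one index *)

Section Lattice.
Context {R : realType}.

Definition lat (n : int) : set R := [set x | exists z : int,
  x = n%:~R^-1 * z%:~R /\ - (n%:~R / 2) <= x < n%:~R / 2].

Lemma grid_inj (m : nat) : (0 < m)%N -> injective (@grid R m).
Proof.
move=> m0 x y /addrI /mulIf; rewrite invr_eq0 mulf_eq0 !pnatr_eq0/= -lt0n.
by move=> /(_ m0)/eqP; rewrite eqr_nat => /eqP.
Qed.

(** The condition on [z / (2 m)] says [- 2 m^2 <= z < 2 m^2]; shifting [z] by [2 m^2] gives a
    natural index. *)
Lemma lat_grid (m : nat) : (0 < m)%N -> lat (2 * m)%:Z = @grid R m @` `I_(4 * m ^ 2).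
Proof.
move=> m0; have mR : 0 < m%:R :> R by rewrite ltr0n.
have E1 : (2 * m)%:Z%:~R = 2 * m%:R :> R by rewrite -natrM.
have gE (z : nat) : grid m z = (2 * m%:R)^-1 * (z%:Z - (2 * m ^ 2)%:Z)%:~R :> R.
  rewrite intrD rmorphN/= /grid -!pmulrn natrM natrX.
  by field; rewrite gt_eqF.
apply/seteqP; split => [x|_ [z /= zm <-]].
- rewrite /lat/= E1 => -[z [-> /andP[lo up]]].
  have h0 : 0 < 2 * m%:R :> R by rewrite mulr_gt0.
  rewrite [leRHS]mulrC ler_pdivlMr// in lo; rewrite [ltLHS]mulrC ltr_pdivrMr// in up.
  have lo' : - (2 * m ^ 2)%:Z <= z.
    rewrite -(ler_int R) rmorphN/= -pmulrn natrM natrX; move: lo; lra.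
  have up' : z < (2 * m ^ 2)%:Z.
    rewrite -(ltr_int R) -pmulrn natrM natrX; move: up; lra.
  exists (absz (z + (2 * m ^ 2)%:Z)).
    rewrite /= -ltz_nat gez0_abs; last lia.
    by lia.
  by rewrite gE gez0_abs ?addrK//; lia.
- exists (z%:Z - (2 * m ^ 2)%:Z); rewrite E1; split; first exact: gE.
  have E2 : 2 * m%:R / 2 = m%:R :> R by field.
  rewrite E2 /grid lerDl mulr_ge0 ?invr_ge0 ?mulr_ge0//=.
  rewrite addrC -ltrBrDr opprK ltr_pdivrMr ?mulr_gt0//.
  rewrite (_ : _ * _ = (4 * m ^ 2)%:R); last by rewrite natrM natrX; ring.
  by rewrite ltr_nat.
Qed.

Lemma finite_lat (m : nat) : (0 < m)%N -> finite_set (lat (2 * m)%:Z).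
Proof. by move=> m0; rewrite lat_grid//; apply: finite_image. Qed.

Lemma finite_funs_lat (m m' : nat) : (0 < m)%N -> (0 < m')%N ->
  finite_set (funs (lat (2 * m)%:Z) (lat (2 * m')%:Z)).
Proof.
move=> m0 m'0; rewrite !lat_grid//.
by apply: finite_funs => x y _ _; exact: grid_inj.
Qed.

Lemma sum_lat (V : nmodType) (F : R -> V) (m : nat) : (0 < m)%N ->
  \sum_(k \in lat (2 * m)%:Z) F k = \sum_(z < 4 * m ^ 2) F (grid m z).
Proof.
move=> m0; rewrite lat_grid// fsbig_image_ord// => x y _ _.
exact: grid_inj.
Qed.

(** The value of [Bxi] at one index; the power of [n'] is that of [eps0]. *)
Definition gauss_trans (xi : R[i]) (n n' : int) (b : R -> R) : R[i] :=
  \sum_(a \in funs (lat n) (lat n')) (n'%:~R ^ (- n ^+ 2))%:C *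
    cexp (- (pi%:C * xi * \sum_(k \in lat n)
      ((a k)%:C + 'i * xi^-1 * (b k)%:C) ^+ 2)).

Lemma gauss_trans_prod (xi : R[i]) (m m' : nat) (b : R -> R) :
  (0 < m)%N -> (0 < m')%N ->
  gauss_trans xi (2 * m)%:Z (2 * m')%:Z b =
  \prod_(z < 4 * m ^ 2) \sum_(y < 4 * m' ^ 2) (2 * m'%:R)^-1%:C *
    cexp (- (pi%:C * xi * ((grid m' y)%:C + 'i * xi^-1 * (b (grid m z))%:C) ^+ 2)).
Proof.
move=> m0 m'0.
have mi : set_inj `I_(4 * m ^ 2) (@grid R m) by move=> x y _ _; exact: grid_inj.
have m'i : set_inj `I_(4 * m' ^ 2) (@grid R m') by move=> x y _ _; exact: grid_inj.
rewrite -(sum_funs_prod mi m'i (fun z x => (2 * m'%:R)^-1%:C *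
    cexp (- (pi%:C * xi * (x%:C + 'i * xi^-1 * (b (grid m z))%:C) ^+ 2)))).
rewrite /gauss_trans -!lat_grid//; apply: eq_fsbigr => a _.
rewrite sum_lat// mulr_sumr -sumrN cexp_sum [RHS]big_split/=; congr (_ * _).
(* The exponent [(2 m)^2] is the number of lattice points, so the normalization splits into one
   factor [1 / (2 m')] per point. *)
rewrite prodr_const card_ord -(rmorphXn (real_complex R))/=; congr (real_complex R _).
rewrite (_ : - _ = - (4 * m ^ 2)%:Z); last by rewrite !PoszM; ring.
by rewrite -exprnN -pmulrn natrM exprVn.
Qed.

Lemma prodc_continuous (s : R[i]) (n : nat) (e : R) : 0 < e ->
  exists2 d : R, 0 < d & forall F : 'I_n -> R[i],
    (forall i, normc (F i - s) < d) -> normc (\prod_(i < n) F i - s ^+ n) < e.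
Proof.
elim: n e => [|n IHn] e e0.
  by exists 1 => // F _; rewrite big_ord0 expr0 subrr normc0.
have s1 : 0 < normc s + 1 by rewrite ltr_wpDl// normc_ge0.
have sn : 0 < normc (s ^+ n) + 1 by rewrite ltr_wpDl// normc_ge0.
have [d d0 Hd] := IHn _ (divr_gt0 (divr_gt0 e0 (ltr0Sn _ 1)) s1).
exists (Num.min 1 (Num.min d (e / 2 / (normc (s ^+ n) + 1)))).
  by rewrite !lt_min ltr01 d0 !divr_gt0.
move=> F HF; rewrite big_ord_recr/= exprSr.
have Fi i : [/\ normc (F i - s) < 1, normc (F i - s) < d &
    normc (F i - s) < e / 2 / (normc (s ^+ n) + 1)].
  by have := HF i; rewrite !lt_min => /and3P[].
set P := \prod_(i < n) _; set x := F ord_max.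
have HP : normc (P - s ^+ n) < e / 2 / (normc s + 1).
  by apply: Hd => i; have [] := Fi (widen_ord (leqnSn n) i).
have [x1 _ x3] := Fi ord_max; rewrite -/x in x1 x3.
have -> : P * x - s ^+ n * s = (P - s ^+ n) * x + s ^+ n * (x - s) by ring.
apply: (le_lt_trans (le_normcD _ _)); rewrite !normcM (splitr e).
have xs : normc x <= normc s + 1.
  by rewrite -[x](subrK s) addrC; apply: (le_trans (le_normcD _ _)); rewrite lerD2l ltW.
apply: ler_ltD.
- apply: (le_trans (ler_pM (normc_ge0 _) (normc_ge0 _) (ltW HP) xs)).
  by rewrite divfK// gt_eqF.
- rewrite ltr_pdivlMr// mulrC in x3; apply: le_lt_trans x3.
  by rewrite ler_wpM2r ?normc_ge0// lerDl.
Qed.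

(** With [m] fixed there are [4 m^2] factors, each close to [1 / sqrt xi], and [prodc_continuous]
    applies. The threshold is chosen before [b]. *)
Lemma gauss_trans_cvg (xi : R[i]) (b0 e : R) (m : nat) :
  0 < complex.Re xi -> (0 < m)%N -> 0 < e ->
  exists m0, forall m', (m0 <= m')%N -> forall b : R -> R,
    (forall k, lat (2 * m)%:Z k -> `|b k| <= b0) ->
  normc (gauss_trans xi (2 * m)%:Z (2 * m')%:Z b -
    (sqrtc xi)^-1 ^ ((2 * m)%:Z ^+ 2)) < e.
Proof.
move=> xi0 m0 e0.
have [d d0 Hd] := prodc_continuous (sqrtc xi)^-1 (4 * m ^ 2) e0.
have [m1 m10 Hm1] := gauss_sum_uniform b0 xi0 d0.
exists m1 => m' m1m' b bb0.
rewrite gauss_trans_prod//; last exact: leq_trans m1m'.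
rewrite (_ : (2 * m)%:Z ^+ 2 = (4 * m ^ 2)%:Z); last by rewrite !PoszM; ring.
rewrite -exprnP; apply: Hd => z; apply: Hm1 => //; apply: bb0.
by rewrite lat_grid//; exists (z : nat) => //=; exact: ltn_ord.
Qed.

End Lattice.

(** * Double ultrapowers as ultrapowers over a product *)

Section UltrapowerClasses.
Context (I : Type) (F : npUltraFilter I).

Lemma uclsD (V : zmodType) (f g : I -> V) :
  ucls F f + ucls F g = ucls F (fun i => f i + g i).
Proof. exact: umap2_cls. Qed.

Lemma uclsN (V : zmodType) (f : I -> V) : - ucls F f = ucls F (fun i => - f i).
Proof. exact: umap_cls. Qed.

Lemma uclsM (A : comNzRingType) (f g : I -> A) :
  ucls F f * ucls F g = ucls F (fun i => f i * g i).
Proof. exact: umap2_cls. Qed.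

Lemma uclsX (A : comNzRingType) (f : I -> A) n :
  ucls F f ^+ n = ucls F (fun i => f i ^+ n).
Proof.
elim: n => [//|n IHn]; rewrite exprS IHn uclsM.
by congr (ucls F _); apply/funext => i; rewrite exprS.
Qed.

Lemma ucls_natr (A : comNzRingType) n : n%:R = ucls F (fun=> n%:R : A).
Proof.
elim: n => [//|n IHn]; rewrite -natr1 IHn.
apply: (etrans (uclsD (fun=> n%:R) (fun=> 1))).
by congr (ucls F _); apply/funext => i; rewrite natr1.
Qed.

Lemma uclsV (A : comUnitRingType) (f : I -> A) :
  (ucls F f)^-1 = ucls F (fun i => (f i)^-1).
Proof. exact: umap_cls. Qed.

Lemma ucls_norm (K : numDomainType) (f : I -> K) :
  `|ucls F f| = ucls F (fun i => `|f i|).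
Proof. exact: umap_cls. Qed.

Lemma ucls_le (K : numDomainType) (f g : I -> K) :
  (ucls F f <= ucls F g) <-> F [set i | f i <= g i].
Proof.
by split=> [/asboolP/urel_cls//|fg]; apply/asboolP/urel_cls.
Qed.

Lemma ucls_lt (K : numDomainType) (f g : I -> K) :
  (ucls F f < ucls F g) <-> F [set i | f i < g i].
Proof.
by split=> [/asboolP/urel_cls//|fg]; apply/asboolP/urel_cls.
Qed.

End UltrapowerClasses.

(* The double ultrapower is the ultrapower over I2 * I1 with respect to the   *)
(* product ultrafilter dfil.                                                  *)
Section DoubleClasses.
Context (I1 I2 : Type) (F1 : npUltraFilter I1) (F2 : npUltraFilter I2).

Definition dfil : set_system (I2 * I1) :=
  [set P | F2 [set i | F1 [set j | P (i, j)]]].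

Lemma dfilE P : dfil P = F2 [set i | F1 [set j | P (i, j)]].
Proof. by []. Qed.

#[global] Instance dfil_filter : ProperFilter dfil.
Proof.
split.
  move=> h; have {}h : F2 [set i | F1 set0] by [].
  apply: (@filter_not_empty _ F2 _); apply: filterS h => i.
  exact: filter_not_empty.
split.
- have : F2 [set i | F1 setT] by apply: filterS filterT => i _; exact: filterT.
  by [].
- move=> P Q FP FQ; have : F2 ([set i | F1 [set j | P (i, j)]] `&`
    [set i | F1 [set j | Q (i, j)]]) by exact: filterI.
  by apply: filterS => i [/= FP' FQ']; exact: filterI.
- move=> P Q PQ FP; have {}FP : F2 [set i | F1 [set j | P (i, j)]] by [].
  have : F2 [set i | F1 [set j | Q (i, j)]]; last by [].
  by apply: filterS FP => i; apply: filterS => j; exact: PQ.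
Qed.

Lemma dfil_fst (P : set I2) : F2 P -> dfil [set p | P p.1].
Proof.
by apply: filterS => i Pi /=; apply: filterS filterT.
Qed.

Lemma dfil_not (A : set (I2 * I1)) : ~ dfil A -> dfil (~` A).
Proof.
move=> /npu_not; apply: filterS => i /npu_not.
exact.
Qed.

(** [npu_forall] twice: over [I2] with functions [I1 -> T] as points, then over [I1]. *)
Lemma dfil_forall (T : Type) (P Q : I2 * I1 -> set T) :
  (forall x : I2 * I1 -> T, dfil [set p | P p (x p)] -> dfil [set p | Q p (x p)]) ->
  dfil [set p | P p `<=` Q p].
Proof.
move=> PQ.
have : F2 [set i | [set x : I1 -> T | F1 [set j | P (i, j) (x j)]] `<=`
    [set x | F1 [set j | Q (i, j) (x j)]]].
  by apply: npu_forall => x; exact: (PQ (fun p => x p.1 p.2)).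
by apply: filterS => i Hi; apply: npu_forall => x; exact: Hi.
Qed.

Definition dcls (T : Type) (f : I2 * I1 -> T) : dpow F1 F2 T :=
  ucls F2 (fun i => ucls F1 (fun j => f (i, j))).

Lemma dclsP (T : Type) (f g : I2 * I1 -> T) :
  dcls f = dcls g <-> dfil [set p | f p = g p].
Proof.
by rewrite dfilE; split=> [/uclsP|h]; [|apply/uclsP]; [apply: filterS => i /uclsP|
  apply: filterS h => i h; apply/uclsP].
Qed.

Lemma dclsW (T : Type) (P : dpow F1 F2 T -> Prop) :
  (forall f, P (dcls f)) -> forall x, P x.
Proof.
move=> Pf; elim/uclsW => f.
have -> : f = fun i => ucls F1 (fun j => urepr (f i) j).
  by apply/funext => i; exact/esym/ureprK.
exact: (Pf (fun p => urepr (f p.1) p.2)).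
Qed.

Lemma starmap_ucls (T : Type) (f : I2 -> T) :
  starmap F1 (ucls F2 f) = dcls (fun p => f p.1).
Proof. exact: umap_cls. Qed.

Lemma dstdE (T : Type) (x : T) : dstd F1 F2 x = dcls (fun=> x).
Proof. exact: starmap_ucls. Qed.

Lemma dmap_dcls (T U : Type) (g : T -> U) (f : I2 * I1 -> T) :
  dmap g (dcls f) = dcls (fun p => g (f p)).
Proof.
rewrite /dmap umap_cls; congr (ucls F2 _); apply/funext => i.
exact: umap_cls.
Qed.

Lemma dmap2_dcls (T U V : Type) (g : T -> U -> V) (f : I2 * I1 -> T) f' :
  dmap2 g (dcls f) (dcls f') = dcls (fun p => g (f p) (f' p)).
Proof.
rewrite /dmap2 umap2_cls; congr (ucls F2 _); apply/funext => i.
exact: umap2_cls.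
Qed.

Lemma dapp_dcls (T U : Type) (g : I2 * I1 -> T -> U) (f : I2 * I1 -> T) :
  dapp (dcls g) (dcls f) = dcls (fun p => g p (f p)).
Proof.
rewrite /dapp umap2_cls; congr (ucls F2 _); apply/funext => i.
exact: umap2_cls.
Qed.

Lemma dclsD (V : zmodType) (f g : I2 * I1 -> V) :
  dcls f + dcls g = dcls (fun p => f p + g p).
Proof. by rewrite uclsD; congr (ucls F2 _); apply/funext => i; rewrite uclsD. Qed.

Lemma dclsN (V : zmodType) (f : I2 * I1 -> V) : - dcls f = dcls (fun p => - f p).
Proof. by rewrite uclsN; congr (ucls F2 _); apply/funext => i; rewrite uclsN. Qed.

Lemma dclsM (A : comNzRingType) (f g : I2 * I1 -> A) :
  dcls f * dcls g = dcls (fun p => f p * g p).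
Proof. by rewrite uclsM; congr (ucls F2 _); apply/funext => i; rewrite uclsM. Qed.

Lemma dclsX (A : comNzRingType) (f : I2 * I1 -> A) n :
  dcls f ^+ n = dcls (fun p => f p ^+ n).
Proof. by rewrite uclsX; congr (ucls F2 _); apply/funext => i; rewrite uclsX. Qed.

Lemma dcls_natr (A : comNzRingType) n :
  n%:R = dcls (fun=> n%:R : A).
Proof. by rewrite ucls_natr; congr (ucls F2 _); apply/funext => i; exact: ucls_natr. Qed.

Lemma dclsV (A : comUnitRingType) (f : I2 * I1 -> A) :
  (dcls f)^-1 = dcls (fun p => (f p)^-1).
Proof. by rewrite uclsV; congr (ucls F2 _); apply/funext => i; rewrite uclsV. Qed.

Lemma dcls_norm (K : numDomainType) (f : I2 * I1 -> K) :
  `|dcls f| = dcls (fun p => `|f p|).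
Proof.
by rewrite ucls_norm; congr (ucls F2 _); apply/funext => i; rewrite ucls_norm.
Qed.

Lemma dcls_le (K : numDomainType) (f g : I2 * I1 -> K) :
  (dcls f <= dcls g) <-> dfil [set p | f p <= g p].
Proof.
by rewrite dfilE; split=> [/ucls_le|h]; [|apply/ucls_le]; [apply: filterS => i /ucls_le|
  apply: filterS h => i h; apply/ucls_le].
Qed.

Lemma dcls_lt (K : numDomainType) (f g : I2 * I1 -> K) :
  (dcls f < dcls g) <-> dfil [set p | f p < g p].
Proof.
by rewrite dfilE; split=> [/ucls_lt|h]; [|apply/ucls_lt]; [apply: filterS => i /ucls_lt|
  apply: filterS h => i h; apply/ucls_lt].
Qed.

Lemma dext_dcls (T : Type) (A : I2 * I1 -> set T) (x : I2 * I1 -> T) :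
  dext (dcls A) (dcls x) <-> dfil [set p | A p (x p)].
Proof.
rewrite dfilE; split=> [/urel_cls|h]; [|apply/urel_cls].
  by apply: filterS => i /urel_cls.
by apply: filterS h => i h; apply/urel_cls.
Qed.

Lemma isum_dcls (T : choiceType) (V : zmodType) (A : I2 * I1 -> set T)
    (f : dpow F1 F2 T -> dpow F1 F2 V) (phi : I2 * I1 -> T -> V) :
  (forall p, finite_set (A p)) ->
  (forall x, dfil [set p | A p (x p)] -> f (dcls x) = dcls (fun p => phi p (x p))) ->
  isum (dext (dcls A)) f = dcls (fun p => \sum_(t \in A p) phi p t).
Proof.
move=> finA fphi; rewrite (@isumE _ _ _ _ _ _ _ _ (dcls phi)) ?dmap2_dcls//.
  apply/upred_cls; apply: filterS filterT => i _ /=.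
  by apply/upred_cls; apply: filterS filterT => j _ /=.
elim/dclsW => x /dext_dcls Ax.
by rewrite fphi// dapp_dcls.
Qed.

End DoubleClasses.

(** * Internal sets and standard parts in terms of families *)

Section InternalSets.
Context (R : realType) (I1 I2 : Type).
Context (F1 : npUltraFilter I1) (F2 : npUltraFilter I2).
Local Notation dcls := (@dcls I1 I2 F1 F2 _).
Local Notation dfil := (@dfil I1 I2 F1 F2).

(** An instance of the theorem of Los: the witness [z] is assembled from witnesses chosen at each
    index, with default 0 where there is none. *)
Lemma latL_ucls (h : I2 -> int) :
  latL (ucls F2 h) = uext (ucls F2 (fun i => @lat R (h i))).
Proof.
have E (x : I2 -> R) (z : I2 -> int) :
    (ucls F2 x = (HR R (ucls F2 h))^-1 * umap intr (ucls F2 z) /\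
     - (HR R (ucls F2 h) / 2) <= ucls F2 x < HR R (ucls F2 h) / 2) <->
    F2 [set i | x i = (h i)%:~R^-1 * (z i)%:~R /\
      - ((h i)%:~R / 2) <= x i < (h i)%:~R / 2].
  rewrite /HR !umap_cls uclsV uclsM (ucls_natr F2 R 2) uclsV uclsM uclsN.
  split=> [[/uclsP e /andP[/ucls_le le /ucls_lt lt]]|H].
    by apply: filterS (filterI e (filterI le lt)) => i /= [-> [-> ->]].
  split; first by apply/uclsP; apply: filterS H => i [].
  apply/andP; split; [apply/ucls_le|apply/ucls_lt];
    by apply: filterS H => i /= [_ /andP[]].
apply/seteqP; split; elim/uclsW => x.
- move=> [z]; elim/uclsW: z => z /E H; apply/urel_cls.
  by apply: filterS H => i /= H; exists (z i).
- move=> /urel_cls H.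
  have /boolp.choice[z zP] : forall i, exists z : int, lat (h i) (x i) ->
      x i = (h i)%:~R^-1 * z%:~R /\ - ((h i)%:~R / 2) <= x i < (h i)%:~R / 2.
    move=> i; have [[z zP]|] := pselect (lat (h i) (x i)); last by exists 0.
    by exists z.
  by exists (ucls F2 z); apply/E; apply: filterS H => i /= /zP.
Qed.

(** By [uext_inj] the internal set chosen in [star_set] is unique, so it is the family of
    lattices. *)
Lemma star_latL (h : I2 -> int) :
  star_set F1 (latL (ucls F2 h)) = dext (dcls (fun p => @lat R (h p.1))).
Proof.
rewrite latL_ucls; apply/seteqP; split => x.
- by move=> [A [/uext_inj <-]]; rewrite starmap_ucls.
- by move=> H; exists (ucls F2 (fun i => lat (h i))); rewrite starmap_ucls.
Qed.

Lemma latL'_dcls (h : I2 * I1 -> int) :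
  latL' (dcls h) = dext (dcls (fun p => @lat R (h p))).
Proof.
have E (x : I2 * I1 -> R) (z : I2 * I1 -> int) :
    (dcls x = (HR' R (dcls h))^-1 * dmap intr (dcls z) /\
     - (HR' R (dcls h) / 2) <= dcls x < HR' R (dcls h) / 2) <->
    dfil [set i | x i = (h i)%:~R^-1 * (z i)%:~R /\
      - ((h i)%:~R / 2) <= x i < (h i)%:~R / 2].
  rewrite /HR' !dmap_dcls dclsV dclsM (dcls_natr F1 F2 R 2) dclsV dclsM dclsN.
  split=> [[/dclsP e /andP[/dcls_le le /dcls_lt lt]]|H].
    by apply: filterS (filterI e (filterI le lt)) => i /= [-> [-> ->]].
  split; first by apply/dclsP; apply: filterS H => i [].
  apply/andP; split; [apply/dcls_le|apply/dcls_lt];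
    by apply: filterS H => i /= [_ /andP[]].
apply/seteqP; split; elim/dclsW => x.
- move=> [z]; elim/dclsW: z => z /E H; apply/dext_dcls.
  by apply: filterS H => i /= H; exists (z i).
- move=> /dext_dcls H.
  have /boolp.choice[z zP] : forall i, exists z : int, lat (h i) (x i) ->
      x i = (h i)%:~R^-1 * z%:~R /\ - ((h i)%:~R / 2) <= x i < (h i)%:~R / 2.
    move=> i; have [[z zP]|] := pselect (lat (h i) (x i)); last by exists 0.
    by exists z.
  by exists (dcls z); apply/E; apply: filterS H => i /= /zP.
Qed.

(** Both conditions in [funX] are universal, so they pass to almost every index by [dfil_forall].
    The condition off the lattice also uses that the complement of an internal set is given by the
    complements, which holds for an ultrafilter. *)
Lemma funX_dcls (h : I2 -> int) (h' : I2 * I1 -> int) :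
  funX (ucls F2 h) (dcls h') =
  dext (dcls (fun p => funs (@lat R (h p.1)) (lat (h' p)))).
Proof.
rewrite /funX star_latL latL'_dcls; apply/seteqP; split; elim/dclsW => a.
- move=> [a1 a2]; apply/dext_dcls.
  have h1 : dfil [set p | lat (h p.1) `<=` [set k | lat (h' p) (a p k)]].
    apply: dfil_forall => x Lx.
    have /dext_dcls//: dext (dcls (fun p => @lat R (h' p)))
      (dcls (fun p => a p (x p))).
    by rewrite -dapp_dcls; apply: a1; apply/dext_dcls.
  have h2 : dfil [set p | ~` lat (h p.1) `<=` [set k | a p k = 0]].
    apply: dfil_forall => x Lx.
    have /dclsP//: dcls (fun p => a p (x p)) = dcls (fun=> 0).
    rewrite -dapp_dcls; apply: a2 => /dext_dcls Lx'.
    apply: (@filter_not_empty _ dfil _).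
    by apply: filterS2 Lx Lx' => p /=.
  by apply: filterS2 h1 h2 => p /= h1 h2; split => k; [exact: h1|exact: h2].
- move=> /dext_dcls Xa; split; elim/dclsW => x Lx; rewrite dapp_dcls.
  + move/dext_dcls: Lx => Lx; apply/dext_dcls.
    by apply: filterS2 Xa Lx => p /= [+ _]; apply.
  + rewrite -[RHS]/(dcls (fun=> 0)); apply/dclsP.
    have /dfil_not Lx' : ~ dfil [set p | lat (h p.1) (x p)].
      by move=> ?; apply: Lx; apply/dext_dcls.
    by apply: filterS2 Xa Lx' => p /= [_ +]; apply.
Qed.

(** Positive elements of the first extension are families [e] that are positive almost everywhere,
    so the tolerance must be allowed to depend on the [I2] index. *)
Lemma st_of_cvg (x : I2 * I1 -> R[i]) (y : I2 -> R[i]) :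
  (forall e : I2 -> R, F2 [set i | 0 < e i] ->
    dfil [set p | normc (x p - y p.1) < e p.1]) ->
  st_dom (dcls x) /\ st (dcls x) = ucls F2 y.
Proof.
move=> xy; split.
  exists (ucls F2 (fun i => normc (y i) + 1)).
  rewrite /starC_of umap_cls starmap_ucls dcls_norm; apply/dcls_le.
  have one0 : F2 [set i | 0 < 1 :> R] by apply: filterS filterT => i _ /=.
  apply: filterS (xy (fun=> 1) one0) => p /= xy1; rewrite -[`|x p|]/((normc (x p))%:C) lecR.
  rewrite -[x p](subrK (y p.1)) addrC (le_trans (le_normcD _ _))//.
  by rewrite lerD2l ltW.
have E (z : I2 -> R[i]) (e : I2 -> R) :
    `|dcls x - starmap F1 (ucls F2 z)| < starmap F1 (starC_of (ucls F2 e)) <->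
    dfil [set p | normc (x p - z p.1) < e p.1].
  rewrite /starC_of umap_cls !starmap_ucls dclsN dclsD dcls_norm.
  split=> [/dcls_lt|H]; [|apply/dcls_lt].
    by apply: filterS => p /=; rewrite -[`|_|]/((normc _)%:C) ltcR.
  by apply: filterS H => p /=; rewrite -[`|_|]/((normc _)%:C) ltcR.
apply: xget_unique => [|z].
  by elim/uclsW => e /ucls_lt e0; apply/E; exact: xy.
elim/uclsW: z => z zP; apply/uclsP.
have [//|/npu_not nzy] := pselect (F2 [set i | z i = y i]).
(* Half the distance between two candidate standard parts contradicts the triangle inequality. *)
pose e i := normc (z i - y i) / 2.
have e0 : F2 [set i | 0 < e i].
  apply: filterS nzy => i /= zy; rewrite divr_gt0// lt_neqAle normc_ge0 andbT.
  by apply/eqP => /esym/eq0_normc/eqP; rewrite subr_eq0 => /eqP.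
have h1 := xy e e0.
have /E h2 : `|dcls x - starmap F1 (ucls F2 z)| < starmap F1 (starC_of (ucls F2 e)).
  by apply: zP; apply/ucls_lt.
exfalso; apply: (@filter_not_empty _ dfil _).
apply: filterS2 h1 h2 => p /= h1 h2.
have : normc (z p.1 - y p.1) <= normc (x p - y p.1) + normc (x p - z p.1).
  rewrite (_ : z p.1 - y p.1 = (x p - y p.1) - (x p - z p.1)); last by ring.
  by apply: normcD_le => //; exact: normcN_le.
by move: h1 h2; rewrite /e; lra.
Qed.

Lemma st0_std (y : R[i]) : st0_dom (std F2 y) /\ st0 (std F2 y) = y.
Proof.
split.
  exists (normc y); rewrite /std ucls_norm; apply/ucls_le.
  by apply: filterS filterT => i _ /=.
have E (z : R[i]) (e : R) :
    `|std F2 y - std F2 z| < std F2 e%:C <-> normc (y - z) < e.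
  rewrite /std uclsN uclsD ucls_norm; split => [/ucls_lt|H].
    by move=> /filter_ex[i /=]; rewrite -[`|_|]/((normc _)%:C) ltcR.
  apply/ucls_lt; apply: filterS filterT => i _ /=.
  by rewrite -[`|_|]/((normc _)%:C) ltcR.
apply: xget_unique => [e e0|z zP]; first by apply/E; rewrite subrr normc0.
apply/eqP; rewrite -subr_eq0; apply/eqP.
have [//|nz] := pselect (z - y = 0).
have n0 : 0 < normc (y - z).
  rewrite lt_neqAle normc_ge0 andbT; apply/eqP => /esym/eq0_normc yz.
  by apply: nz; rewrite -opprB yz oppr0.
by have /E := zP _ n0; rewrite ltxx.
Qed.

End InternalSets.

(** Positivity holds only almost everywhere for a given representative; [.-1.+1] replaces a zero by
    1, so that the finite statements apply at every index. *)
Lemma even_gt0_ucls (I : Type) (F : npUltraFilter I) (H : upow F int) :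
  0 < H -> (exists K, H = 2 * K) ->
  exists2 m : I -> nat, (forall i, (0 < m i)%N) &
    H = ucls F (fun i => (2 * m i)%:Z).
Proof.
move=> H0 [K HK]; elim/uclsW: K HK => k; rewrite ucls_natr uclsM => HK.
exists (fun i => (absz (k i)).-1.+1) => //; rewrite HK; apply/uclsP.
move: H0; rewrite HK => /ucls_lt; apply: filterS => i /=.
by rewrite pmulr_rgt0// => ki; lia.
Qed.

Lemma even_gt0_dcls (I1 I2 : Type) (F1 : npUltraFilter I1)
    (F2 : npUltraFilter I2) (H : dpow F1 F2 int) :
  0 < H -> (exists K, H = 2 * K) ->
  exists2 m : I2 * I1 -> nat, (forall p, (0 < m p)%N) &
    H = dcls F1 F2 (fun p => (2 * m p)%:Z).
Proof.
move=> H0 [K HK]; elim/dclsW: K HK => k; rewrite dcls_natr dclsM => HK.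
exists (fun p => (absz (k p)).-1.+1) => //; rewrite HK; apply/dclsP.
move: H0; rewrite HK -[0]/(dcls F1 F2 (fun=> 0)) => /dcls_lt.
apply: filterS => i /=.
by rewrite pmulr_rgt0// => ki; lia.
Qed.

(** * The transforms as families of finite sums *)

Section Transforms.
Context (R : realType) (I1 I2 : Type).
Context (F1 : npUltraFilter I1) (F2 : npUltraFilter I2).
Context (m : I2 -> nat) (m' : I2 * I1 -> nat).
Context (m_gt0 : forall i, (0 < m i)%N) (m'_gt0 : forall p, (0 < m' p)%N).
Local Notation dcls := (@dcls I1 I2 F1 F2 _).
Local Notation dfil := (@dfil I1 I2 F1 F2).
Local Notation h := (fun i => (2 * m i)%:Z).
Local Notation h' := (fun p => (2 * m' p)%:Z).
Local Notation H := (ucls F2 h).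
Local Notation H' := (dcls h').
Local Notation latp p := (@lat R (2 * m p.1)%:Z).
Local Notation funsp p := (funs (latp p) (lat (2 * m' p)%:Z)).
Local Notation eps p := ((2 * m' p)%:Z%:~R ^ (- (2 * m p.1)%:Z ^+ 2) : R).

Lemma sumL_dcls (V : zmodType) (f : dpow F1 F2 R -> dpow F1 F2 V)
    (phi : I2 * I1 -> R -> V) :
  (forall x, f (dcls x) = dcls (fun p => phi p (x p))) ->
  sumL H f = dcls (fun p => \sum_(k \in latp p) phi p k).
Proof.
move=> fphi; rewrite /sumL star_latL; apply: isum_dcls => // p.
exact: finite_lat.
Qed.

Lemma sumX_dcls (V : zmodType) (f : dpow F1 F2 (R -> R) -> dpow F1 F2 V)
    (phi : I2 * I1 -> (R -> R) -> V) :
  (forall x, f (dcls x) = dcls (fun p => phi p (x p))) ->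
  isum (funX H H') f = dcls (fun p => \sum_(a \in funsp p) phi p a).
Proof.
move=> fphi; rewrite funX_dcls; apply: isum_dcls => // p.
exact: finite_funs_lat.
Qed.

Lemma dC_of_dcls (x : I2 * I1 -> R) : dC_of (dcls x) = dcls (fun p => (x p)%:C).
Proof. exact: dmap_dcls. Qed.

Lemma gauss_dcls (xi : R[i]) (c : dpow F1 F2 R -> dpow F1 F2 R[i])
    (c' : I2 * I1 -> R -> R[i]) :
  (forall x, c (dcls x) = dcls (fun p => c' p (x p))) ->
  gauss H xi c = dcls (fun p =>
    cexp (- (pi%:C * xi * \sum_(k \in latp p) c' p k ^+ 2))).
Proof.
move=> cc'; rewrite /gauss (@sumL_dcls _ _ (fun p k => c' p k ^+ 2)).
  by rewrite !dstdE !dclsM dclsN /dexp dmap_dcls.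
by move=> x; rewrite cc' dclsX.
Qed.

Lemma gaussX_dcls (xi : R[i]) (a : I2 * I1 -> R -> R) :
  gaussX H xi (dcls a) = dcls (fun p =>
    cexp (- (pi%:C * xi * \sum_(k \in latp p) (a p k)%:C ^+ 2))).
Proof.
rewrite /gaussX (@gauss_dcls _ _ (fun p k => (a p k)%:C))// => x.
by rewrite dapp_dcls dC_of_dcls.
Qed.

Lemma eps0_dcls : eps0 R H H' = dcls (fun p => eps p).
Proof.
by rewrite /eps0 /HR' dmap_dcls starmap_ucls dclsX dclsN dmap2_dcls.
Qed.

Lemma FT_dcls (xi : R[i]) (b : I2 * I1 -> R -> R) :
  FT H H' (gaussX H xi) (dcls b) = dcls (fun p =>
    \sum_(a \in funsp p) (eps p)%:C *
      cexp (- (2 * pi%:C * 'i * (\sum_(k \in latp p) a k * b p k)%:C)) *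
      cexp (- (pi%:C * xi * \sum_(k \in latp p) (a k)%:C ^+ 2))).
Proof.
apply: sumX_dcls => a; rewrite gaussX_dcls eps0_dcls dC_of_dcls.
rewrite (@sumL_dcls _ _ (fun p k => a p k * b p k)); last first.
  by move=> x; rewrite !dapp_dcls dclsM.
rewrite dC_of_dcls !dstdE (dcls_natr F1 F2 R[i] 2) !dclsM dclsN.
by rewrite /dexp dmap_dcls !dclsM.
Qed.

Lemma Bxi_dcls (xi : R[i]) (b : I2 * I1 -> R -> R) :
  Bxi H H' xi (dcls b) =
  dcls (fun p => gauss_trans xi (2 * m p.1)%:Z (2 * m' p)%:Z (b p)).
Proof.
apply: sumX_dcls => a; rewrite eps0_dcls dC_of_dcls.
rewrite (@sumL_dcls _ _ (fun p k => ((a p k)%:C + 'i * xi^-1 * (b p k)%:C) ^+ 2)).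
  by rewrite !dstdE !dclsM dclsN /dexp dmap_dcls dclsM.
by move=> x; rewrite !dapp_dcls !dC_of_dcls !dstdE dclsV !dclsM dclsD dclsX.
Qed.

(** The square is completed at each lattice point; the last factor does not depend on [a] and leaves
    the sum. *)
Lemma gauss_trans_square (xi : R[i]) (p : I2 * I1) (b : R -> R) : xi != 0 ->
  \sum_(a \in funsp p) (eps p)%:C *
      cexp (- (2 * pi%:C * 'i * (\sum_(k \in latp p) a k * b k)%:C)) *
      cexp (- (pi%:C * xi * \sum_(k \in latp p) (a k)%:C ^+ 2)) =
  gauss_trans xi (2 * m p.1)%:Z (2 * m' p)%:Z b *
  cexp (- (pi%:C * xi * \sum_(k \in latp p) ((b k)%:C / xi) ^+ 2)).
Proof.
move=> xi0; rewrite /gauss_trans mulr_fsuml; apply: eq_fsbigr => a _.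
rewrite -[LHS]mulrA -[RHS]mulrA -!cexpD !sum_lat//; congr (_ * cexp _).
rewrite rmorph_sum !mulr_sumr -!sumrN -!big_split; apply: eq_bigr => z _ /=.
rewrite rmorphM/=.
set A := (a _)%:C; set B := (b _)%:C.
have -> : (A + 'i * xi^-1 * B) ^+ 2 =
    A ^+ 2 + 2 * (A * ('i * xi^-1 * B)) + 'i ^+ 2 * (xi^-1 * B) ^+ 2 by ring.
by rewrite sqr_i; move: (pi%:C) => q; field.
Qed.

(** The threshold of [gauss_trans_cvg] depends on [i] through [m i], [b0 i] and [e i]. It is passed
    because [H'] exceeds every family indexed by [I2], in particular [2 * m0 i]. *)
Lemma Bxi_cvg (xi : R[i]) (b : I2 * I1 -> R -> R) (b0 e : I2 -> R) :
  0 < complex.Re xi ->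
  (forall n : I2 -> int, dfil [set p | n p.1 < (2 * m' p)%:Z]) ->
  dfil [set p | forall k, latp p k -> `|b p k| <= b0 p.1] ->
  F2 [set i | 0 < e i] ->
  dfil [set p | normc (gauss_trans xi (2 * m p.1)%:Z (2 * m' p)%:Z (b p) -
    (sqrtc xi)^-1 ^ ((2 * m p.1)%:Z ^+ 2)) < e p.1].
Proof.
move=> xi0 H'oo bb0 e0.
have /boolp.choice[m0 m0P] : forall i, exists m0 : nat, 0 < e i ->
    forall m', (m0 <= m')%N -> forall b : R -> R,
    (forall k, lat (2 * m i)%:Z k -> `|b k| <= b0 i) ->
    normc (gauss_trans xi (2 * m i)%:Z (2 * m')%:Z b -
      (sqrtc xi)^-1 ^ ((2 * m i)%:Z ^+ 2)) < e i.
  move=> i; have [ei|] := ltP 0 (e i); last by exists 0.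
  by have [m0 ?] := gauss_trans_cvg (b0 i) xi0 (m_gt0 i) ei; exists m0.
apply: filterS3 (dfil_fst F1 e0) (H'oo (fun i => (2 * m0 i)%:Z)) bb0 => p /=.
move=> ep mp bp; apply: m0P => //.
by lia.
Qed.

(** For fixed [i] each lattice point has its own [F1]-large set of good [j]. The lattice is finite,
    so these sets have an [F1]-large intersection, on which the bound holds at all points at
    once. *)
Lemma bounded_dcls (b : I2 * I1 -> R -> R) (b0 : I2 -> R) :
  (forall k : upow F2 R, latL H k ->
    `|dapp (dcls b) (starmap F1 k)| <= starmap F1 (ucls F2 b0)) ->
  dfil [set p | forall k, latp p k -> `|b p k| <= b0 p.1].
Proof.
rewrite latL_ucls => bb0.
have : F2 [set i | lat (2 * m i)%:Z `<=`
    [set k | F1 [set j | `|b (i, j) k| <= b0 i]]].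
  apply: npu_forall => k Lk.
  have /bb0 : uext (ucls F2 (fun i => @lat R (2 * m i)%:Z)) (ucls F2 k).
    by apply/urel_cls.
  rewrite !starmap_ucls dapp_dcls dcls_norm => /dcls_le.
  by [].
rewrite dfilE; apply: filterS => i Hi.
rewrite /= lat_grid// in Hi *.
have : F1 [set j | forall z : 'I_(4 * m i ^ 2),
    `|b (i, j) (grid (m i) z)| <= b0 i].
  apply: filter_forall => z; apply: Hi.
  by exists (z : nat) => //=; exact: ltn_ord.
by apply: filterS => j bj _ [z /= zm <-]; exact: (bj (Ordinal zm)).
Qed.

End Transforms.

Theorem theorem3p3 (R : realType) (I1 I2 : Type)
    (I1_infinite : infinite_set [set: I1]) (I2_infinite : infinite_set [set: I2])
    (F1 : npUltraFilter I1) (F2 : npUltraFilter I2)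
    (H : upow F2 int) (H_gt0 : 0 < H)
    (H_even : exists K : upow F2 int, H = 2 * K)
    (H_infinite : forall n : int, std F2 n < H)
    (H' : dpow F1 F2 int) (H'_gt0 : 0 < H')
    (H'_even : exists K : dpow F1 F2 int, H' = 2 * K)
    (H'_infinite : forall n : upow F2 int, starmap F1 n < H')
    (xi : R[i]) (xi_gt0 : 0 < complex.Re xi) :
  funA H H' (gaussX H xi) /\
  forall b : dpow F1 F2 (R -> R), funX H H' b ->
    [/\ FT H H' (gaussX H xi) b =
          Bxi H H' xi b *
          gauss H xi (fun k => dC_of (dapp b k) / dstd F1 F2 xi),
        Bxi H H' xi b *
          gauss H xi (fun k => dC_of (dapp b k) / dstd F1 F2 xi) =
          Bxi H H' xi b *
          dexp (- (dstd F1 F2 (pi%:C) / dstd F1 F2 xi *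
                   sumL H (fun k => dC_of (dapp b k) ^+ 2))) &
        (exists b0 : upow F2 R, forall k : upow F2 R, latL H k ->
           `|dapp b (starmap F1 k)| <= starmap F1 b0) ->
        let c : upow F2 R[i] := starC_expz (std F2 (sqrtc xi)^-1) (H ^+ 2) in
        [/\ st_dom (Bxi H H' xi b),
            st (Bxi H H' xi b) = c,
            bst_dom (Bxi H H' xi b / starmap F1 c) &
            bst (Bxi H H' xi b / starmap F1 c) = 1]].
Proof.
have [m m_gt0 HE] := even_gt0_ucls H_gt0 H_even.
have [m' m'_gt0 H'E] := even_gt0_dcls H'_gt0 H'_even.
have xi0 : xi != 0 by apply/eqP => xi0; move: xi_gt0; rewrite xi0 ltxx.
have s0 : (sqrtc xi)^-1 != 0 by rewrite invr_eq0 sqrtc_eq0.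
rewrite HE H'E in H'_infinite *; split.
  exists (dcls F1 F2 (fun p a =>
    cexp (- (pi%:C * xi * \sum_(k \in lat (2 * m p.1)%:Z) (a k)%:C ^+ 2)))).
  by elim/dclsW => a _; rewrite gaussX_dcls// dapp_dcls.
elim/dclsW => b _.
have gE : gauss (ucls F2 (fun i => (2 * m i)%:Z)) xi
    (fun k => dC_of (dapp (dcls F1 F2 b) k) / dstd F1 F2 xi) =
    dcls F1 F2 (fun p => cexp (- (pi%:C * xi *
      \sum_(k \in lat (2 * m p.1)%:Z) ((b p k)%:C / xi) ^+ 2))).
  rewrite (@gauss_dcls _ _ _ _ _ _ m_gt0 _ _ (fun p k => (b p k)%:C / xi))// => x.
  by rewrite dapp_dcls dC_of_dcls dstdE dclsV dclsM.
split.
- rewrite gE FT_dcls// Bxi_dcls// dclsM; congr (dcls _ _ _).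
  by apply/funext => p; exact: gauss_trans_square.
- rewrite gE; congr (_ * _).
  rewrite (@sumL_dcls _ _ _ _ _ _ m_gt0 _ _ (fun p k => (b p k)%:C ^+ 2)); last first.
    by move=> x; rewrite dapp_dcls dC_of_dcls dclsX.
  rewrite !dstdE dclsV !dclsM dclsN /dexp dmap_dcls; congr (dcls _ _ _).
  apply/funext => p; congr (cexp (- _)).
  rewrite !sum_lat// !mulr_sumr; apply: eq_bigr => z _.
  by move: (pi%:C) => q; field.
- move=> [b0]; elim/uclsW: b0 => b0 /(bounded_dcls m_gt0) bb0.
  have H'oo (n : I2 -> int) : dfil F1 F2 [set p | n p.1 < (2 * m' p)%:Z].
    by have := H'_infinite (ucls F2 n); rewrite starmap_ucls => /dcls_lt.
  rewrite Bxi_dcls// /starC_expz /std uclsX umap2_cls starmap_ucls dclsV dclsM.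
  pose B p := gauss_trans xi (2 * m p.1)%:Z (2 * m' p)%:Z (b p).
  pose c i : R[i] := (sqrtc xi)^-1 ^ ((2 * m i)%:Z ^+ 2).
  have Bc e : F2 [set i | 0 < e i] ->
      dfil F1 F2 [set p | normc (B p - c p.1) < e p.1].
    exact: (Bxi_cvg m_gt0 xi_gt0 H'oo bb0).
  have c0 i : c i != 0 by rewrite expfz_neq0.
  have nc0 i : 0 < normc (c i).
    rewrite lt_neqAle normc_ge0 andbT eq_sym.
    by apply: contra (c0 i) => /eqP/eq0_normc ->.
  (* The absolute estimate is used with tolerance [e i * normc (c i)], which is legitimate since [c]
     depends only on [i] and never vanishes. *)
  have Bc1 e : F2 [set i | 0 < e i] ->
      dfil F1 F2 [set p | normc (B p / c p.1 - 1) < e p.1].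
    move=> e0; have ec0 : F2 [set i | 0 < e i * normc (c i)].
      by apply: filterS e0 => i /= ?; rewrite mulr_gt0.
    apply: filterS (Bc _ ec0) => p /= Bcp.
    have -> : B p / c p.1 - 1 = (B p - c p.1) / c p.1 by field.
    by rewrite normcM normcV ltr_pdivrMr.
  have [dB sB] := st_of_cvg Bc.
  have [dBc sBc] := @st_of_cvg _ _ _ F1 F2 (fun p => B p / c p.1) (fun=> 1) Bc1.
  have [d1 s1] := st0_std F2 (1 : R[i]).
  split; [exact: dB|exact: sB|split; first exact: dBc|].
    by rewrite sBc; exact: d1.
  by rewrite /bst sBc; exact: s1.
Qed.
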